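(* Let $\mathfrak g$ be a semisimple Lie algebra over an algebraically closed field $\Bbbk$ of characteristic zero, let $\mathfrak g=\mathfrak g_0\oplus\mathfrak g_1$ be a $\mathbb Z_2$-grading of $\mathfrak g$, and let $\mathfrak k=\mathfrak g_0\ltimes\mathfrak g_1$ be the corresponding $\mathbb Z_2$-contraction. Suppose that the grading is $\mathcal N$-regular, i.e. $\mathfrak g_1$ contains a regular nilpotent element of $\mathfrak g$. Then $\Bbbk[\mathfrak k^*]^{K^u}=\Bbbk[\mathfrak k^*]^{\mathfrak g_1}$ is a maximal commutative subalgebra of the Poisson algebra $\Bbbk[\mathfrak k^*]=\mathcal S(\mathfrak k)$.
   Context: A $\mathbb Z_2$-grading $\mathfrak g=\mathfrak g_0\oplus\mathfrak g_1$ is the decomposition into $(-1)^i$-eigenspaces $\mathfrak g_i$ of an involutory automorphism of $\mathfrak g$. The $\mathbb Z_2$-contraction $\mathfrak k=\mathfrak g_0\ltimes\mathfrak g_1$ is the Lie algebra equal to $\mathfrak g_0\oplus\mathfrak g_1$ as a vector space, with the bracket of $\mathfrak g$ on $\mathfrak g_0\times\mathfrak g_0$ and $\mathfrak g_0\times\mathfrak g_1$, and $[\mathfrak g_1,\mathfrak g_1]=0$. Let $G$ be the adjoint group of $\mathfrak g$ and $G_0\subset G$ the connected subgroup with Lie algebra $\mathfrak g_0$; the corresponding connected algebraic group is $K=G_0\ltimes\mathfrak g_1$, and $K^u\simeq\exp(\mathfrak g_1)$ is its commutative normal unipotent subgroup with Lie algebra $\mathfrak g_1$. $K$ acts on $\mathfrak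 k^*$ by the coadjoint representation, and $\Bbbk[\mathfrak k^*]^{\mathfrak g_1}$ denotes the algebra of polynomial functions on $\mathfrak k^*$ invariant under the ideal $\mathfrak g_1\subset\mathfrak k$. The symmetric algebra $\mathcal S(\mathfrak k)=\Bbbk[\mathfrak k^*]$ carries the Lie–Poisson bracket, $\{f_1,f_2\}(\xi)=\langle[(df_1)_\xi,(df_2)_\xi],\xi\rangle$. A subalgebra is commutative if the bracket vanishes on it, and maximal commutative if it is commutative and not properly contained in another commutative subalgebra. An element of $\mathfrak g$ is regular if its centraliser in $\mathfrak g$ has dimension $\operatorname{rk}\mathfrak g$. *)

(* Defs.v *)
From HB Require Import structures.
From mathcomp Require Import all_boot all_order all_algebra.
From mathcomp Require Import boolp.
From mathcomp Require Import mpoly.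
Set Implicit Arguments.
Unset Strict Implicit.
Unset Printing Implicit Defensive.
Import GRing.Theory.
Local Open Scope ring_scope.

(* Finite-dimensional Lie algebras: a [vectType] is finite-dimensional. *)
HB.mixin Record Vector_isLieAlgebra (K : fieldType) L of Vector K L := {
  bracket : L -> L -> L;
  bracket_linearr : forall (x : L) (a : K) (y z : L),
    bracket x (a *: y + z) = a *: bracket x y + bracket x z;
  bracketxx : forall x : L, bracket x x = 0;
  bracketDl : forall x y z : L, bracket (x + y) z = bracket x z + bracket y z;
  jacobi : forall x y z : L,
    bracket x (bracket y z) + bracket y (bracket z x)
      + bracket z (bracket x y) = 0 }.

#[short(type="lieAlgType")]
HB.structure Definition LieAlgebra (K : fieldType) :=
  { L of Vector K L & Vector_isLieAlgebra K L }.

Section LieTheory.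
Variables (K : fieldType) (L : lieAlgType K).
Implicit Types (x y z : L) (U V : {vspace L}).

HB.instance Definition _ x :=
  GRing.isLinear.Build K L L _ (bracket x : L -> L) (bracket_linearr x).

Lemma bracketC x y : bracket x y = - bracket y x.
Proof.
apply/eqP; rewrite -addr_eq0; apply/eqP.
have := bracketxx (x + y).
by rewrite bracketDl !linearD /= !bracketxx add0r addr0.
Qed.

Lemma bracket0l y : bracket 0 y = 0.
Proof. by rewrite bracketC linear0 oppr0. Qed.

Lemma bracketZl a x y : bracket (a *: x) y = a *: bracket x y.
Proof. by rewrite bracketC linearZ /= -scalerN -bracketC. Qed.

Lemma bracket_suml I (r : seq I) (P : pred I) (E : I -> L) y :
  bracket (\sum_(i <- r | P i) E i) y = \sum_(i <- r | P i) bracket (E i) y.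
Proof.
rewrite bracketC linear_sum -sumrN.
by apply: eq_bigr => i _; rewrite -bracketC.
Qed.

Definition ad x : 'End(L) := linfun (bracket x).

Definition centraliser x : {vspace L} := lker (ad x).

(* The spaces [ker (ad x)^n] increase with [n] and are stationary from
   [n = \dim L] on. *)
Definition nilspace x : {vspace L} :=
  iter (\dim {:L}) (fun V => (ad x @^-1: V)%VS) 0%VS.

Lemma rank_subproof : exists r, `[< exists x, \dim (nilspace x) = r >].
Proof. by exists (\dim (nilspace 0)); apply/asboolP; exists 0. Qed.

(* Since [\dim (nilspace x)] is the multiplicity of the root 0 of the
   characteristic polynomial of [ad x], this is the rank in the sense of
   Bourbaki (Lie, VII, 2.2). *)
Definition rank : nat := ex_minn rank_subproof.

Definition regular x : Prop := \dim (centraliser x) = rank.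

Definition ad_nilpotent x : Prop :=
  exists n, forall y, iter n (bracket x) y = 0.

Definition bracketv U V : {vspace L} :=
  <<[seq bracket x y | x <- vbasis U, y <- vbasis V]>>%VS.

Definition ideal U : Prop := forall x y, y \in U -> bracket x y \in U.

Definition solvable U : Prop :=
  exists n, iter n (fun V => bracketv V V) U = 0%VS.

Definition semisimple : Prop := forall U, ideal U -> solvable U -> U = 0%VS.

End LieTheory.

Arguments rank {K} L.
Arguments semisimple {K} L.

Section PoissonAlgebra.
Variables (K : fieldType) (L : lieAlgType K).
Implicit Types (x y : L) (xi : 'Hom(L, K^o)).

(* The algebra S(L) = K[L^*] of polynomial functions on L^*: the variable 'X_i
   is the [i]-th vector of the basis [vbasis {:L}], seen as a linear form on
   L^*. The dual space L^* is ['Hom(L, K^o)]. *)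
Definition symAlg : Type := {mpoly K[\dim {:L}]}.
HB.instance Definition _ := GRing.ComNzRing.on symAlg.
HB.instance Definition _ := GRing.Algebra.on symAlg.

Implicit Types f g : symAlg.

Definition lbase (i : 'I_(\dim {:L})) : L := (vbasis {:L})`_i.

Definition sym_of x : symAlg :=
  \sum_i coord (vbasis {:L}) i x *: ('X_i : {mpoly K[\dim {:L}]}).

Definition pderiv i f : symAlg := mderiv i f.

Definition peval f xi : K := meval (fun i => xi (lbase i)) f.

(* The differential of [f] at [xi], through the identification L^** = L. *)
Definition pdiff f xi : L := \sum_i peval (pderiv i f) xi *: lbase i.

Definition poisson f g : symAlg :=
  \sum_i \sum_j pderiv i f * pderiv j g * sym_of (bracket (lbase i) (lbase j)).

(* The action of [x] on functions induced by the coadjoint representation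
   (ad* x) xi = - xi \o ad x; it is the derivation of S(L) extending [ad x]. *)
Definition lie_act x f : symAlg :=
  \sum_i pderiv i f * sym_of (bracket x (lbase i)).

Lemma peval_sym_of x xi : peval (sym_of x) xi = xi x.
Proof.
rewrite /peval /sym_of raddf_sum /= [in RHS](coord_vbasis (memvf x)) linear_sum.
by apply: eq_bigr => i _; rewrite mevalZ mevalXU linearZ.
Qed.

Lemma poissonE f g xi :
  peval (poisson f g) xi = xi (bracket (pdiff f xi) (pdiff g xi)).
Proof.
rewrite {1}/pdiff bracket_suml linear_sum /poisson /peval raddf_sum.
apply: eq_bigr => i _ /=; rewrite bracketZl linearZ /pdiff /=.
rewrite (linear_sum (bracket (lbase i))) (linear_sum xi) [RHS]scaler_sumr.
rewrite raddf_sum; apply: eq_bigr => j _ /=.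
rewrite !mevalM -/(peval (sym_of _) xi) peval_sym_of.
by rewrite !linearZ /= /peval -mulrA; exact: mulrCA.
Qed.

Lemma lie_actE x f xi : peval (lie_act x f) xi = xi (bracket x (pdiff f xi)).
Proof.
rewrite /pdiff (linear_sum (bracket x)) (linear_sum xi) /lie_act /peval raddf_sum.
apply: eq_bigr => i _ /=.
by rewrite mevalM -/(peval (sym_of _) xi) peval_sym_of !linearZ.
Qed.

(* The exponential series of [ad x], truncated at the order [\dim L], beyond
   which it vanishes when [ad x] is nilpotent. *)
Definition exp_ad x : 'End(L) :=
  \sum_(n < (\dim {:L}).+1)
     (n`!%:R : K)^-1 *: iter n (fun h => (ad x \o h)%VF) \1%VF.

(* The coadjoint action of [exp x] on L^*, for [ad x] nilpotent. *)
Definition coexp x xi : 'Hom(L, K^o) := (xi \o exp_ad (- x))%VF.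

Definition subalgebra (A : symAlg -> Prop) : Prop :=
  [/\ A 1,
      forall f g, A f -> A g -> A (f + g),
      forall f g, A f -> A g -> A (f * g) &
      forall (a : K) f, A f -> A (a *: f)].

Definition commutative_subalgebra (A : symAlg -> Prop) : Prop :=
  subalgebra A /\ forall f g, A f -> A g -> poisson f g = 0.

Definition maximal_commutative_subalgebra (A : symAlg -> Prop) : Prop :=
  commutative_subalgebra A /\
  forall B : symAlg -> Prop, commutative_subalgebra B ->
    (forall f, A f -> B f) -> forall f, B f -> A f.

End PoissonAlgebra.

Record involution (K : fieldType) (g : lieAlgType K) := Involution {
  invol_fun :> 'End(g);
  involM : forall x y : g,
    invol_fun (bracket x y) = bracket (invol_fun x) (invol_fun y);
  involK : forall x : g, invol_fun (invol_fun x) = x }.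

Section Contraction.
Variables (K : fieldType) (g : lieAlgType K) (theta : involution g).
Implicit Types x y z : g.

Definition gr0 : {vspace g} := passmx.leigenspace theta 1.
Definition gr1 : {vspace g} := passmx.leigenspace theta (-1).

Definition N_regular : Prop :=
  exists e : g, [/\ e \in gr1, ad_nilpotent e & regular e].

(* The projections onto [gr0] and [gr1] (outside characteristic 2). *)
Definition pr0 x : g := 2%:R^-1 *: (x + theta x).
Definition pr1 x : g := 2%:R^-1 *: (x - theta x).

Definition contr_bracket x y : g :=
  bracket (pr0 x) (pr0 y) + bracket (pr0 x) (pr1 y) + bracket (pr1 x) (pr0 y).

Lemma mem_gr0 x : (x \in gr0) = (theta x == x).
Proof.
by rewrite memv_ker !lfun_simp scale1r /= subr_eq0.
Qed.

Lemma mem_gr1 x : (x \in gr1) = (theta x == - x).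
Proof.
by rewrite memv_ker !lfun_simp scaleN1r opprK addr_eq0.
Qed.

Lemma pr0_is_linear : linear pr0.
Proof.
move=> a x y; rewrite /pr0 linearP addrACA -scalerDr /= scalerDr.
by rewrite !scalerA [a * _]mulrC.
Qed.
HB.instance Definition _ := GRing.isLinear.Build K g g _ pr0 pr0_is_linear.

Lemma pr1_is_linear : linear pr1.
Proof.
move=> a x y; rewrite /pr1 linearP opprD addrACA -scalerBr /= scalerDr.
by rewrite !scalerA [a * _]mulrC.
Qed.
HB.instance Definition _ := GRing.isLinear.Build K g g _ pr1 pr1_is_linear.

Lemma pr0_gr0 x : theta (pr0 x) = pr0 x.
Proof. by rewrite linearZ linearD /= involK addrC. Qed.

Lemma pr1_gr1 x : theta (pr1 x) = - pr1 x.
Proof. by rewrite linearZ linearB /= involK -scalerN opprB. Qed.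

Lemma pr0_add_pr1 x : (2%:R : K) != 0 -> pr0 x + pr1 x = x.
Proof.
move=> h; rewrite -scalerDr addrACA subrr addr0 -mulr2n -scaler_nat scalerA.
by rewrite mulVf ?scale1r.
Qed.

Lemma pr0M x y : pr0 (bracket (pr0 x) y) = bracket (pr0 x) (pr0 y).
Proof. by rewrite /pr0 involM -/(pr0 x) pr0_gr0 -linearD -linearZ. Qed.

Lemma pr1M x y : pr1 (bracket (pr0 x) y) = bracket (pr0 x) (pr1 y).
Proof. by rewrite /pr1 involM pr0_gr0 -linearB -linearZ. Qed.

Lemma pr0K x : pr0 (pr0 x) = pr0 x.
Proof.
rewrite {1}/pr0 pr0_gr0 -mulr2n -scaler_nat scalerA.
have [/eqP h|h] := boolP ((2%:R : K) == 0); last by rewrite mulVf ?scale1r.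
by rewrite /pr0 h invr0 !scale0r scaler0.
Qed.

Lemma pr1K x : pr1 (pr1 x) = pr1 x.
Proof.
rewrite {1}/pr1 pr1_gr1 opprK -mulr2n -scaler_nat scalerA.
have [/eqP h|h] := boolP ((2%:R : K) == 0); last by rewrite mulVf ?scale1r.
by rewrite /pr1 h invr0 !scale0r scaler0.
Qed.

Lemma pr0_pr1 x : pr0 (pr1 x) = 0.
Proof. by rewrite /pr0 pr1_gr1 subrr scaler0. Qed.

Lemma pr1_pr0 x : pr1 (pr0 x) = 0.
Proof. by rewrite /pr1 pr0_gr0 subrr scaler0. Qed.

Lemma pr0_contr x y : pr0 (contr_bracket x y) = bracket (pr0 x) (pr0 y).
Proof.
rewrite /contr_bracket [bracket (pr1 x) _]bracketC !(linearD, linearN) /= !pr0M.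
by rewrite !pr0_pr1 pr0K !linear0 !addr0.
Qed.

Lemma pr1_contr x y :
  pr1 (contr_bracket x y) = bracket (pr0 x) (pr1 y) + bracket (pr1 x) (pr0 y).
Proof.
rewrite /contr_bracket [bracket (pr1 x) _]bracketC !(linearD, linearN) /= !pr1M.
by rewrite !pr1_pr0 !pr1K linear0 add0r.
Qed.

Lemma contr00 x y : (2%:R : K) != 0 -> x \in gr0 -> y \in gr0 ->
  contr_bracket x y = bracket x y.
Proof.
move=> h; rewrite !mem_gr0 /contr_bracket /pr1 => /eqP hx /eqP hy.
rewrite hx hy !subrr !scaler0 linear0 bracket0l !addr0.
have E z : theta z = z -> pr0 z = z.
  by move=> hz; rewrite -[RHS]pr0_add_pr1 // /pr1 hz subrr scaler0 addr0.
by rewrite !E.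
Qed.

Lemma contr01 x y : (2%:R : K) != 0 -> x \in gr0 -> y \in gr1 ->
  contr_bracket x y = bracket x y.
Proof.
move=> h; rewrite mem_gr0 mem_gr1 /contr_bracket => /eqP hx /eqP hy.
have x1 : pr1 x = 0 by rewrite /pr1 hx subrr scaler0.
have y0 : pr0 y = 0 by rewrite /pr0 hy subrr scaler0.
have := pr0_add_pr1 x h; rewrite x1 addr0 => ->.
have := pr0_add_pr1 y h; rewrite y0 add0r => ->.
by rewrite bracket0l linear0 add0r addr0.
Qed.

Lemma contr11 x y : x \in gr1 -> y \in gr1 -> contr_bracket x y = 0.
Proof.
rewrite !mem_gr1 /contr_bracket => /eqP hx /eqP hy.
have x0 : pr0 x = 0 by rewrite /pr0 hx subrr scaler0.
have y0 : pr0 y = 0 by rewrite /pr0 hy subrr scaler0.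
by rewrite x0 y0 !bracket0l linear0 !addr0.
Qed.

Lemma contr_linearr x a y z :
  contr_bracket x (a *: y + z) = a *: contr_bracket x y + contr_bracket x z.
Proof.
rewrite /contr_bracket !linearP !scalerDr.
by rewrite [RHS](AC (3*3) ((1*4)*(2*5)*(3*6))).
Qed.

Lemma contrxx x : contr_bracket x x = 0.
Proof.
by rewrite /contr_bracket bracketxx add0r [X in _ + X]bracketC subrr.
Qed.

Lemma contrDl x y z :
  contr_bracket (x + y) z = contr_bracket x z + contr_bracket y z.
Proof.
rewrite /contr_bracket !linearD /= !bracketDl.
by rewrite [RHS](AC (3*3) ((1*4)*(2*5)*(3*6))).
Qed.

Lemma contr_jacobi x y z :
  contr_bracket x (contr_bracket y z) + contr_bracket y (contr_bracket z x)
    + contr_bracket z (contr_bracket x y) = 0.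
Proof.
have E u v w : contr_bracket u (contr_bracket v w) =
    bracket (pr0 u) (bracket (pr0 v) (pr0 w)) +
    (bracket (pr0 u) (bracket (pr0 v) (pr1 w)) +
     bracket (pr0 u) (bracket (pr1 v) (pr0 w)) +
     bracket (pr1 u) (bracket (pr0 v) (pr0 w))).
  by rewrite {1}/contr_bracket pr0_contr pr1_contr linearD /= !addrA.
rewrite !E [X in X + _]addrACA [LHS]addrACA jacobi add0r.
have J1 := jacobi (pr0 x) (pr0 y) (pr1 z).
have J2 := jacobi (pr0 x) (pr1 y) (pr0 z).
have J3 := jacobi (pr1 x) (pr0 y) (pr0 z).
set a1 := bracket (pr0 x) (bracket (pr0 y) (pr1 z)) in J1 *.
set a2 := bracket (pr0 y) (bracket (pr1 z) (pr0 x)) in J1 *.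
set a3 := bracket (pr1 z) _ in J1 *.
set b1 := bracket (pr0 x) (bracket (pr1 y) (pr0 z)) in J2 *.
set b2 := bracket (pr1 y) _ in J2 *.
set b3 := bracket (pr0 z) (bracket (pr0 x) (pr1 y)) in J2 *.
set c1 := bracket (pr1 x) _ in J3 *.
set c2 := bracket (pr0 y) (bracket (pr0 z) (pr1 x)) in J3 *.
set c3 := bracket (pr0 z) (bracket (pr1 x) (pr0 y)) in J3 *.
transitivity ((a1 + a2 + a3) + (b1 + b2 + b3) + (c1 + c2 + c3)); last first.
  by rewrite J1 J2 J3 !addr0.
by rewrite [RHS](AC ((3*3)*3) ((1*4*7)*(8*2*5)*(6*9*3))).
Qed.

End Contraction.

(* The contraction has the underlying space of [g]; the alias, indexed by the
   involution, carries the other bracket. *)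
Definition contraction (K : fieldType) (g : lieAlgType K)
  (theta : involution g) : Type := g.

Section ContractionLie.
Variables (K : fieldType) (g : lieAlgType K) (theta : involution g).

HB.instance Definition _ := Vector.on (contraction theta).
HB.instance Definition _ :=
  Vector_isLieAlgebra.Build K (contraction theta)
    (contr_linearr theta) (contrxx theta) (contrDl theta) (contr_jacobi theta).

Implicit Type f : symAlg (contraction theta).

(* K^u = exp(g_1); for [x] in [gr1 theta] the square of [ad x] on
   [contraction theta] is zero. *)
Definition Ku_invariant f : Prop :=
  forall x : contraction theta, x \in gr1 theta ->
  forall xi : 'Hom(contraction theta, K^o), peval f (coexp x xi) = peval f xi.

Definition gr1_invariant f : Prop :=
  forall x : contraction theta, x \in gr1 theta -> lie_act x f = 0.

End ContractionLie.

(* Main.v *)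
(** Maximality is immediate: [g_1] is commutative in the contraction, so every
    [x] in [g_1] is a [g_1]-invariant function, and a function that
    Poisson-commutes with all of them is [g_1]-invariant.

    For commutativity, let [f] be invariant and [xi] a linear form.  Invariance
    says that the [g_0]-component [y] of [(df)_xi] satisfies
    [xi([x, y]) = 0] for [x] in [g_1]; if [a] represents the restriction of [xi]
    to [g_1] through the Killing form, this means [[a, y] = 0].  Then
    [{f1, f2}(xi) = xi([y1, y2])], which vanishes as soon as the centraliser of
    [a] is commutative.  This holds when [a] is regular, and the regular [a] are
    dense because [g_1] contains one regular element [e]: on the line through
    [e] and [a] all but finitely many elements are regular.

    The centraliser of a regular [x] is commutative because [ad] has maximal rank
    at [x]: the first-order condition for [rank (ad x + t ad w) <= rank (ad x)]
    is that [ad w] maps [ker (ad x)] into [im (ad x)], which for [y], [z] in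
    [ker (ad x)] gives [kappa(w, [y, z]) = 0].  That the rank (defined by
    nilspaces) bounds the dimension of every centraliser from below follows from
    the commutativity of the nilspace [H] of a generic element: [H] is nilpotent
    and [kappa] is nondegenerate on it, whereas a central element of [H] in
    [[H, H]] is ad-nilpotent, hence orthogonal to [H].  Nondegeneracy of [kappa]
    is Cartan's criterion. *)
From HB Require Import structures.
Require Import Defs.
From mathcomp Require Import all_boot all_order all_algebra.
From mathcomp Require Import boolp.
From mathcomp Require Import mpoly.
Set Implicit Arguments.
Unset Strict Implicit.
Unset Printing Implicit Defensive.
Import Order.TTheory GRing.Theory Num.Theory.
Local Open Scope ring_scope.

(** * Ranks and spectral decomposition *)

Section LinearAlgebra.

Lemma pchar0_natr (F : fieldType) : [pchar F] =i pred0 ->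
  forall n, (n%:R == 0 :> F) = (n == 0)%N.
Proof. by move/pcharf0P. Qed.

Lemma poly_nonroot (F : fieldType) : [pchar F] =i pred0 ->
  forall p : {poly F}, p != 0 -> exists t, p.[t] != 0.
Proof.
move=> ch p p0; apply: contrapT => H.
have uq : uniq [seq i%:R : F | i <- iota 0 (size p)].
  rewrite map_inj_uniq ?iota_uniq // => i j.
  wlog le_ij : i j / (i <= j)%N.
    by move=> W; case/orP: (leq_total i j) => [/W//|/W W' /esym /W' ->].
  move/eqP; rewrite eq_sym -subr_eq0 -natrB // pchar0_natr // subn_eq0 => le_ji.
  by apply/eqP; rewrite eqn_leq le_ij.
have := max_poly_roots p0 _ uq; rewrite size_map size_iota ltnn.
suff h : all (root p) [seq i%:R | i <- iota 0 (size p)] by move/(_ h).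
by apply/allP => t _; apply: contra_notT H => ht; exists t.
Qed.

(** The density argument on a line: if [p] were nonzero, [p * q] would have a non-root, against the
    hypothesis there. *)
Lemma poly_eq0_cofinite (F : fieldType) : [pchar F] =i pred0 ->
  forall p q : {poly F}, q != 0 -> (forall t, q.[t] != 0 -> p.[t] = 0) -> p = 0.
Proof.
move=> ch p q q0 H; apply/eqP; apply: contraT => p0.
have [t] := poly_nonroot ch (mulf_neq0 p0 q0).
by rewrite hornerM mulf_eq0 negb_or => /andP[/eqP pt /H].
Qed.

(** Lower semicontinuity of the rank. Compressing [M] by one-sided inverses of the two factors of
    [A] gives a square matrix of size [\rank A] that is the identity at [t0]; its determinant is the
    required polynomial. *)
Lemma rank_open (F : fieldType) m n (M : 'M[{poly F}]_(m, n)) (t0 : F) :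
  exists2 p : {poly F}, p.[t0] != 0 & forall t, p.[t] != 0 ->
    (\rank (map_mx (horner_eval t0) M) <= \rank (map_mx (horner_eval t) M))%N.
Proof.
set A := map_mx _ M; set r := \rank A.
have /row_fullP[P hP] : row_full (col_base A) by exact: col_base_full.
have /row_freeP[Q hQ] : row_free (row_base A) by exact: row_base_free.
pose D := map_mx polyC P *m M *m map_mx polyC Q.
have hD t : map_mx (horner_eval t) D = P *m map_mx (horner_eval t) M *m Q.
  rewrite !map_mxM -!map_mx_comp; congr (_ *m _ *m _);
  by apply/matrixP => i j; rewrite !mxE /= /horner_eval hornerC.
exists (\det D).
  rewrite -/(horner_eval t0 _) -det_map_mx hD -/A -[A in P *m A]mulmx_base.
  by rewrite mulmxA hP mul1mx hQ det1 oner_neq0.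
move=> t; rewrite -/(horner_eval t _) -det_map_mx hD => h.
have : P *m map_mx (horner_eval t) M *m Q \in unitmx by rewrite unitmxE unitfE.
rewrite -row_free_unit -row_leq_rank => /leq_trans; apply.
by rewrite -/r; apply: leq_trans (mxrankM_maxl _ _) _; exact: mxrankM_maxr.
Qed.

(* The tangent space at [A] of the variety of matrices of rank at most
   [\rank A]. *)
Lemma rank_tangent (F : fieldType) n (A B : 'M[F]_n) : [pchar F] =i pred0 ->
  (forall t, \rank (A + t *: B)%R <= \rank A)%N ->
  forall v : 'rV_n, v *m A = 0 -> (v *m B <= A)%MS.
Proof.
move=> ch H v vA; apply: contraT => nvB.
have /row_fullP[P hP] : row_full (col_base A) by exact: col_base_full.
(* At [t = 0] the upper rows form a basis of the row space of [A], and the extra row [v *m B] raises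
   the rank by one. For [t != 0] that row equals [t^-1 *: (v *m (A + t *: B))], so all rows lie in
   the row space of [A + t *: B], whose rank is at most [\rank A]. *)
pose M : 'M[{poly F}]_(\rank A + 1, n) :=
  col_mx (map_mx polyC (P *m A) + 'X *: map_mx polyC (P *m B))
         (map_mx polyC (v *m B)).
have hM t : map_mx (horner_eval t) M = col_mx (P *m (A + t *: B)) (v *m B).
  rewrite map_col_mx; congr col_mx; apply/matrixP => i j; last first.
    by rewrite !mxE /horner_eval hornerC.
  rewrite mulmxDr -scalemxAr !mxE /horner_eval !(hornerE).
  by rewrite ?mxE.
have [p p0 hp] := rank_open M 0.
have [t] : exists t, ('X * p).[t] != 0.
  apply: poly_nonroot => //; rewrite mulf_neq0 ?polyX_eq0 //.
  by apply: contraNneq p0 => ->; rewrite horner0.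
rewrite hornerM hornerX mulf_eq0 negb_or => /andP[t0 /hp].
rewrite !hM scale0r addr0 => le_r.
have r1 : \rank (col_mx (P *m A) (v *m B)) = (\rank A).+1.
  have -> : P *m A = row_base A by rewrite -[A in P *m A]mulmx_base mulmxA hP mul1mx.
  have lt1 : (row_base A < col_mx (row_base A) (v *m B))%MS.
    rewrite ltmxE; apply/andP; split; first by rewrite -addsmxE addsmxSl.
    apply: contra nvB => le1.
    have leA : (row_base A <= A)%MS by rewrite eq_row_base.
    apply: submx_trans leA; apply: submx_trans le1.
    by rewrite -addsmxE addsmxSr.
  apply/eqP; rewrite eqn_leq; apply/andP; split; last first.
    by have := rank_ltmx lt1; rewrite eq_row_base.
  by apply: leq_trans (rank_leq_row _) _; rewrite addn1.
have : (col_mx (P *m (A + t *: B)) (v *m B) <= (A + t *: B)%R)%MS.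
  rewrite col_mx_sub; apply/andP; split; first exact: submxMl.
  have -> : v *m B = t^-1 *: (v *m (A + t *: B)).
    by rewrite mulmxDr vA add0r -scalemxAr scalerA mulVf // scale1r.
  by rewrite scalemx_sub // submxMl.
move/mxrankS => le2; have := leq_trans (leq_trans le_r le2) (H t).
by rewrite r1 ltnn.
Qed.

(** In a full-rank factorisation [E = C *m R], idempotence cancels to [R *m C = 1], and the two
    products have the same trace. *)
Lemma mxtrace_idem (F : fieldType) n (E : 'M[F]_n) :
  E *m E = E -> \tr E = (\rank E)%:R.
Proof.
move=> idE; rewrite -[E in LHS]mulmx_base mxtrace_mulC.
suff -> : row_base E *m col_base E = 1%:M by rewrite mxtrace1.
have /row_fullP[P hP] : row_full (col_base E) by exact: col_base_full.
have /row_freeP[Q hQ] : row_free (row_base E) by exact: row_base_free.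
move: (col_base E) (row_base E) (mulmx_base E) hP hQ => C R eE hP hQ.
have : P *m ((C *m R) *m (C *m R)) *m Q = P *m (C *m R) *m Q by rewrite eE idE.
by rewrite !mulmxA hP !mul1mx -!mulmxA hQ !mulmx1.
Qed.

(** Induction on the size: if [A = C *m R] is rank deficient, [R *m C] is a smaller nilpotent matrix
    with the same trace; a nilpotent matrix of full rank has size 0. *)
Lemma mxtrace_nilp (F : fieldType) n (A : 'M[F]_n) k : A ^+ k = 0 -> \tr A = 0.
Proof.
elim/ltn_ind: n k A => n IH k A Ak.
have [lt_r|] := ltnP (\rank A) n.
  rewrite -[A]mulmx_base mxtrace_mulC.
  apply: (IH _ lt_r k.+1).
  move: (col_base A) (row_base A) (mulmx_base A) => C R eA.
  have E j : (R *m C) ^+ j.+1 = R *m (C *m R) ^+ j *m C.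
    elim: j => [|j IHj]; first by rewrite expr1 expr0 mulmx1.
    by rewrite exprS IHj exprS -!mulmxE !mulmxA.
  by rewrite E eA Ak mulmx0 mul0mx.
case: n A Ak {IH} => [|n] A Ak le_r; first by rewrite /mxtrace big_ord0.
have uA : A \in unitmx by rewrite -row_full_unit -col_leq_rank.
have : A ^+ k \is a GRing.unit by apply: unitrX.
by rewrite Ak unitr0.
Qed.

Lemma prod_dvdp (F : fieldType) (I : eqType) (s : seq I) (q : I -> {poly F}) d :
  uniq s -> {in s &, forall i j, i != j -> coprimep (q i) (q j)} ->
  {in s, forall i, q i %| d} -> \prod_(i <- s) q i %| d.
Proof.
elim: s => [|a s IH] /=; first by rewrite big_nil dvd1p.
move=> /andP[ns us] hc hd; rewrite big_cons Gauss_dvdp.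
  rewrite hd ?mem_head //=; apply: IH => // [i j hi hj|i hi].
    by apply: hc; rewrite in_cons ?hi ?hj orbT.
  by apply: hd; rewrite in_cons hi orbT.
rewrite big_seq; apply: (big_ind (coprimep (q a))) => [||i hi].
- exact: coprimep1.
- by move=> x y hx hy; rewrite coprimepMr hx.
- apply: hc; rewrite ?mem_head ?in_cons ?hi ?orbT //.
  by apply: contraNneq ns => ->.
Qed.

(** The idempotents of the Chinese remainder theorem, modulo the product of the [q i]: a Bezout
    relation between [q i] and the product of the others provides [e i]. *)
Lemma partition_of_unity (F : fieldType) k (q : 'I_k -> {poly F}) :
  (forall i j, i != j -> coprimep (q i) (q j)) ->
  exists e : 'I_k -> {poly F}, [/\
    \prod_i q i %| 1 - \sum_i e i,
    forall i, \prod_i q i %| e i * (1 - e i),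
    forall i j, i != j -> \prod_i q i %| e i * e j &
    forall i, \prod_i q i %| q i * e i].
Proof.
move=> hc; pose Q i := \prod_(j | j != i) q j.
have QE i : \prod_i q i = q i * Q i by rewrite (bigD1 i).
have /choice[uv huv] i : exists uv : {poly F} * {poly F},
    uv.1 * q i + uv.2 * Q i = 1.
  apply/Bezout_eq1_coprimepP; rewrite /Q.
  apply: (big_ind (coprimep (q i))) => [||j hj].
  - exact: coprimep1.
  - by move=> x y hx hy; rewrite coprimepMr hx.
  - by apply: hc; rewrite eq_sym.
have qQ i j : i != j -> q i %| Q j.
  by move=> ij; rewrite /Q (bigD1 i) //= dvdp_mulIl.
exists (fun i => (uv i).2 * Q i); split => [|i|i j ij|i].
- rewrite -[index_enum _]/(index_enum 'I_k).
  apply: prod_dvdp => [|i j _ _|i _]; [exact: index_enum_uniq | exact: hc |].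
  rewrite (bigD1 i) //= opprD addrA dvdp_add //.
    by rewrite -(huv i) addrK dvdp_mulIr.
  rewrite dvdpNr; apply: (big_ind (fun x => q i %| x)) => [||j hj]; first exact: dvdp0.
    by move=> x y; exact: dvdp_add.
  by apply: dvdp_mull; apply: qQ; rewrite eq_sym.
- have -> : 1 - (uv i).2 * Q i = (uv i).1 * q i by rewrite -[1](huv i) addrK.
  by rewrite (QE i) mulrACA [Q i * _]mulrC dvdp_mull.
- by rewrite (QE j) mulrACA dvdp_mull // dvdp_mul // qQ // eq_sym.
- by rewrite (QE i) mulrCA dvdp_mull.
Qed.

Lemma horner_mx_stable (F : fieldType) n (A : 'M[F]_n.+1) (p : {poly F}) m
    (U : 'M_(m, n.+1)) : (U *m A <= U)%MS -> (U *m horner_mx A p <= U)%MS.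
Proof.
move=> st; elim/poly_ind: p => [|p c IH]; first by rewrite rmorph0 mulmx0 sub0mx.
rewrite rmorphD rmorphM /= horner_mx_X horner_mx_C mulmxDr addmx_sub //.
  by rewrite mulmxA; apply: submx_trans st; exact: submxMr.
by rewrite mul_mx_scalar scalemx_sub.
Qed.

(** The projections onto the generalised eigenspaces are polynomials in [A]; this accounts for the
    last two properties. *)
Lemma spectral (F : closedFieldType) n (A : 'M[F]_n) :
  exists k (l : 'I_k -> F) (E : 'I_k -> 'M[F]_n), 
  [/\ injective l, \sum_i E i = 1%:M,
      forall i j, E i *m E j = if i == j then E i else 0,
      forall i, (A - (l i)%:M) ^+ n *m E i = 0 &
      (forall i B, comm_mx A B -> comm_mx (E i) B) /\
      forall i m (U : 'M_(m, n)), (U *m A <= U)%MS -> (U *m E i <= U)%MS].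
Proof.
case: n A => [|n] A.
  exists 0%N, (fun=> 0), (fun=> 0); split.
  - by case.
  - by rewrite big_ord0; apply/matrixP => - [].
  - by case.
  - by case.
  - by split; case.
have [r hr] := closed_field_poly_normal (char_poly A).
pose s := undup r; pose k := size s.
pose l (i : 'I_k) : F := s`_i.
have linj : injective l.
  by move=> i j /eqP; rewrite nth_uniq ?undup_uniq // => /eqP/val_inj.
(* The size of the matrix bounds every multiplicity, so the characteristic polynomial divides the
   product of the [q i]. *)
pose q i := ('X - (l i)%:P) ^+ n.+1.
have hc i j : i != j -> coprimep (q i) (q j).
  move=> ij; rewrite /q coprimep_expr // coprimep_expl //.
  by rewrite coprimep_XsubC root_XsubC (inj_eq linj) // eq_sym.
have hQ : horner_mx A (\prod_i q i) = 0.
  suff /dvdpP[c ->] : char_poly A %| \prod_i q i.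
    by rewrite rmorphM /= Cayley_Hamilton mulr0.
  have szr : size r = n.+1.
    have := size_char_poly A; rewrite hr (monicP (char_poly_monic A)) scale1r.
    by rewrite size_prod_XsubC => - [].
  rewrite hr (monicP (char_poly_monic A)) scale1r.
  have -> : \prod_i q i = \prod_(z <- s) ('X - z%:P) ^+ n.+1.
    by rewrite (big_nth 0) big_mkord.
  rewrite -prodr_undup_exp_count.
  rewrite big_seq [X in _ %| X]big_seq /=.
  elim/big_rec2: _ => [|z p1 p2 hz IH]; first exact: dvdpp.
  by rewrite dvdp_mul // dvdp_exp2l // -szr count_size.
have dv p : \prod_i q i %| p -> horner_mx A p = 0.
  by case/dvdpP => c ->; rewrite rmorphM /= hQ mulr0.
have [e [e1 e2 e3 e4]] := partition_of_unity hc.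
exists k, l, (fun i => horner_mx A (e i)); split => //.
- move/dv/eqP: e1; rewrite rmorphB rmorph1 rmorph_sum /= subr_eq0.
  by move=> /eqP <-.
- move=> i j; rewrite -[_ *m _]/(_ * _) -rmorphM; case: eqVneq => [<-|ij].
    have /dv/eqP := e2 i; rewrite mulrBr mulr1 rmorphB subr_eq0 /=.
    by move/eqP.
  by apply: dv; exact: e3.
- move=> i; have /dv := e4 i; rewrite rmorphM rmorphXn rmorphB /=.
  by rewrite horner_mx_X horner_mx_C.
split => [i B hB|i m U]; last exact: horner_mx_stable.
exact: comm_horner_mx.
Qed.

End LinearAlgebra.

(** * Rational relations between scalars *)

Section RationalDual.

Lemma clear_denominators k (v : 'I_k -> rat) :
  exists (d : int) (w : 'I_k -> int), d != 0 /\ forall i, d%:~R * v i = (w i)%:~R.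
Proof.
exists (\prod_j denq (v j)), (fun i => numq (v i) * \prod_(j | j != i) denq (v j)).
split=> [|i].
  by apply/prodf_neq0 => j _; exact: denq_neq0.
by rewrite (bigD1 i) //= !intrM mulrAC [_ * v i]mulrC -numqE.
Qed.

(* [phi] is an integral vector orthogonal to all integral relations between the
   [l i]; it replaces a [Q]-linear form on the span of the [l i]. *)
Lemma rational_dual (F : fieldType) k (l : 'I_k -> F) (i0 : 'I_k) :
  [pchar F] =i pred0 -> l i0 != 0 ->
  exists2 phi : 'I_k -> int, exists i, phi i != 0 &
    forall q : 'I_k -> int, \sum_i (q i)%:~R * l i = 0 -> \sum_i q i * phi i = 0.
Proof.
move=> ch li0; pose lc : 'cV[F]_k := \col_i l i.
pose Q m (M : 'M[int]_(m, k)) : 'M[rat]_(m, k) := map_mx intr M.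
(* [M] will be a system of integral relations of maximal rank; [phi] is an integral multiple of a
   nonzero rational vector in its kernel. *)
pose P r := `[< exists m (M : 'M[int]_(m, k)),
  map_mx intr M *m lc = 0 /\ \rank (Q m M) = r >].
have exP : exists r, P r.
  exists 0%N; apply/asboolP; exists 0%N, 0.
  by rewrite map_mx0 mul0mx; split=> //; apply/eqP; rewrite -leqn0 rank_leq_row.
have leP r : P r -> (r <= k)%N.
  by case/asboolP => m [M [_ <-]]; exact: rank_leq_col.
case: (ex_maxnP exP leP) => r /asboolP[m [M [Ml rM]]] maxr.
(* With full rank, some square integral submatrix has a nonzero determinant, which stays nonzero in
   [F] by characteristic zero; then all [l i] would vanish. *)
have [fullM|nfull] := boolP (row_full (Q m M)).
  pose M' := rowsub (fullrankfun fullM) M.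
  have M'u : (map_mx intr M' : 'M[rat]_k) \in unitmx.
    by rewrite /M' map_mxsub; apply: fullrowsub_unit.
  have dM' : (\det M')%:~R != 0 :> F.
    move: M'u; rewrite unitmxE unitfE det_map_mx !intr_eq0.
    case: (\det M') => d; rewrite ?NegzE ?mulrNz ?oppr_eq0 -pmulrn pchar0_natr //.
  have /matrixP/(_ i0 0) : lc = 0.
    have u : (map_mx intr M' : 'M[F]_k) \in unitmx.
      by rewrite unitmxE unitfE det_map_mx.
    rewrite -[lc](mulKmx u) /M' map_mxsub mul_rowsub_mx Ml.
    by apply/matrixP => i j; rewrite !mxE big1 // => ? _; rewrite !mxE mulr0.
  by rewrite !mxE => /eqP; rewrite (negPf li0).
have [c Mc c0] : exists2 c : 'cV[rat]_k, Q m M *m c = 0 & c != 0.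
  have : cokermx (Q m M) != 0.
    by rewrite -mxrank_eq0 mxrank_coker subn_eq0 -ltnNge ltn_neqAle rank_leq_col andbT.
  case/matrix0Pn => i [j cij]; exists (col j (cokermx (Q m M))).
    by rewrite colE mulmxA mulmx_coker mul0mx.
  by apply/matrix0Pn; exists i, 0; rewrite mxE.
have [d [w [d0 hw]]] := clear_denominators (fun i => c i 0).
exists w.
  case/matrix0Pn: c0 => i [j]; rewrite ord1 => ci; exists i.
  by rewrite -(intr_eq0 rat) -hw mulf_neq0 // intr_eq0.
move=> q ql; pose qr : 'rV[int]_k := \row_i q i.
(* By maximality of the rank, every further relation is a rational combination of the rows of
   [M]. *)
have sub : (Q 1%N qr <= Q m M)%MS.
  apply: contraT => nsub.
  have : P (\rank (col_mx (Q m M) (Q 1%N qr))).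
    apply/asboolP; exists (m + 1)%N, (col_mx M qr); split.
      rewrite map_col_mx mul_col_mx Ml; apply/eqP; rewrite col_mx_eq0 eqxx /=.
      by apply/eqP/matrixP => i j; rewrite !mxE -[RHS]ql; apply: eq_bigr => a _; rewrite !mxE.
    by rewrite /Q map_col_mx.
  move/maxr; rewrite leqNgt -rM => /negP[].
  apply: rank_ltmx; rewrite ltmxE -addsmxE addsmxSl.
  by apply: contra nsub; rewrite col_mx_sub => /andP[].
case/submxP: sub => D hD.
have : Q 1%N qr *m c = 0 by rewrite hD -mulmxA Mc mulmx0.
move/matrixP/(_ 0 0); rewrite !mxE => e.
apply/eqP; rewrite -(intr_eq0 rat) rmorph_sum /=; apply/eqP.
rewrite -[RHS](mulr0 (d%:~R : rat)) -[in RHS]e mulr_sumr; apply: eq_bigr => i _.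
by rewrite intrM -hw !mxE mulrCA.
Qed.

End RationalDual.

(** * Engel's theorem *)

Section Engel.
Variables (F : fieldType) (L : lieAlgType F).
Implicit Types (x y z : L) (M W U : {vspace L}).

Lemma exists_max_dim (V : vectType F) (P : {vspace V} -> Prop) :
  (exists U : {vspace V}, P U) ->
  exists2 U : {vspace V}, P U & forall U' : {vspace V}, P U' -> (\dim U' <= \dim U)%N.
Proof.
move=> [U0 PU0].
have exP : exists r, `[< exists2 U : {vspace V}, P U & \dim U = r >].
  by exists (\dim U0); apply/asboolP; exists U0.
have leP r : `[< exists2 U : {vspace V}, P U & \dim U = r >] -> (r <= \dim {:V})%N.
  by case/asboolP => U _ <-; apply/dimvS/subvf.
case: (ex_maxnP exP leP) => r /asboolP[U PU <-] maxr; exists U => // U' PU'.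
by apply: maxr; apply/asboolP; exists U'.
Qed.

Lemma memv_addline U z y : y \in (U + <[z]>)%VS ->
  exists2 u, u \in U & exists a : F, y = u + a *: z.
Proof.
case/memv_addP => u hu [v /vlineP[a ->] ->]; exists u => //; by exists a.
Qed.

Definition subalg M := {in M &, forall x y, bracket x y \in M}.
Definition acts_on M W := forall x y, x \in M -> y \in W -> bracket x y \in W.

(* Engel's theorem for the action on [W / U], without forming the quotient. *)
Lemma engel M W U : subalg M -> acts_on M W -> acts_on M U ->
  (U <= W)%VS -> ~~ (W <= U)%VS ->
  (forall x y, x \in M -> y \in M -> exists k, iter k (bracket x) y = 0) ->
  (forall x w, x \in M -> w \in W -> exists k, iter k (bracket x) w \in U) ->
  exists v, [/\ v \in W, v \notin U & forall x, x \in M -> bracket x v \in U].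
Proof.
have [r] := ubnP (\dim M); elim: r M W U => // r IH M W U /ltnSE leM.
move=> sM aW aU sUW nWU nilM nilW.
have [M0|M0] := eqVneq M 0%VS.
  case/subvPn: nWU => v vW vU; exists v; split=> // x.
  by rewrite M0 memv0 => /eqP ->; rewrite bracket0l mem0v.
(* [N] is a maximal proper subalgebra. The induction hypothesis for [N] acting on [M / N] gives [z]
   normalising [N], whence [M = N + <[z]>]. *)
have [|N [sN NM NnM] maxN] := @exists_max_dim L
    (fun N => [/\ subalg N, (N <= M)%VS & N <> M]).
  exists 0%VS; split; rewrite ?sub0v //; last by move/esym/eqP; rewrite (negPf M0).
  by move=> x y; rewrite !memv0 => /eqP -> _; rewrite bracket0l.
have nMN : ~~ (M <= N)%VS.
  by apply/negP => MN; apply: NnM; apply/eqP; rewrite eqEsubv NM.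
have ltN : (\dim N < r)%N.
  apply: leq_trans leM; rewrite ltnNge; apply: contra nMN => leMN.
  by rewrite -(eqP (_ : N == M)) // eqEdim NM.
have inM x : x \in N -> x \in M by move/(subvP NM).
have [z [zM zN Nz]] : exists z,
    [/\ z \in M, z \notin N & forall x, x \in N -> bracket x z \in N].
  apply: IH => //.
  - by move=> x y /inM; exact: sM.
  - by move=> x y /inM xM /inM; exact: nilM.
  - by move=> x y /inM xM /(nilM _ _ xM)[k hk]; exists k; rewrite hk mem0v.
have zN' x : x \in N -> bracket z x \in N.
  by move=> /Nz; rewrite bracketC rpredN.
have eM : (N + <[z]>)%VS = M.
  have sNz : (N + <[z]> <= M)%VS by rewrite subv_add NM -memvE.
  apply: contrapT => neM.
  have /maxN : [/\ subalg (N + <[z]>)%VS, (N + <[z]> <= M)%VS & (N + <[z]>)%VS <> M].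
    split=> // _ _ /memv_addline[x xN [a ->]] /memv_addline[y yN [b ->]].
    rewrite bracketDl !linearD !linearZ /= !bracketZl bracketxx !scaler0 addr0.
    apply: subvP (addvSl _ _) _ _.
    apply: rpredD; [apply: rpredD; [exact: sN|] |]; apply: rpredZ.
      exact: Nz.
    exact: zN'.
  apply/negP; rewrite -ltnNge; apply: contraNltn zN => leN.
  have /eqP -> : N == (N + <[z]>)%VS by rewrite eqEdim addvSl.
  by apply: subvP (addvSr _ _) _ _; exact: memv_line.
have [v [vW vU Nv]] : exists v,
    [/\ v \in W, v \notin U & forall x, x \in N -> bracket x v \in U].
  apply: IH => //.
  - by move=> x y /inM; exact: aW.
  - by move=> x y /inM; exact: aU.
  - by move=> x y /inM xM /inM; exact: nilM.
  - by move=> x y /inM; exact: nilW.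
(* Since [z] normalises [N], the vectors killed by [N] modulo [U] are stable under [z]; the last
   iterate of [v] under [z] outside [U] is then killed by [z] too. *)
pose good u := [/\ u \in W & forall x, x \in N -> bracket x u \in U].
have zgood u : good u -> good (bracket z u).
  case=> uW Nu; split; first exact: aW.
  move=> x xN; have := jacobi x z u; rewrite -addrA => /eqP; rewrite addr_eq0.
  move/eqP ->; rewrite rpredN rpredD //.
    by rewrite [bracket u x]bracketC linearN rpredN; apply: aU => //; exact: Nu.
  by rewrite bracketC rpredN; apply: Nu; exact: Nz.
have itgood k : good (iter k (bracket z) v).
  by elim: k => [|k IHk]; [split | apply: zgood].
have [k hk] := nilW z v zM vW.
have ex : exists k, iter k (bracket z) v \in U by exists k.
case: (ex_minnP ex) => - [|m] hm minm; first by rewrite /= (negPf vU) in hm.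
exists (iter m (bracket z) v); have [h1 h2] := itgood m; split=> //.
  by apply/negP => /minm; rewrite ltnn.
move=> x; rewrite -eM => /memv_addline[y yN [a ->]].
by rewrite bracketDl bracketZl; apply: rpredD; [exact: h2 | apply: rpredZ; exact: hm].
Qed.

Lemma bracketvP U W x y : x \in U -> y \in W -> bracket x y \in bracketv U W.
Proof.
move=> /coord_vbasis -> /coord_vbasis ->; rewrite bracket_suml.
apply: rpred_sum => i _; rewrite linear_sum; apply: rpred_sum => j _ /=.
rewrite bracketZl linearZ /= !rpredZ //; apply: memv_span.
by apply/allpairsP; exists ((vbasis U)`_i, (vbasis W)`_j); rewrite !mem_nth ?size_tuple.
Qed.

(** Coefficients are absorbed into the left argument of the bracket, so [P] need not be closed under
    scaling. *)
Lemma bracketv_ind U W (P : L -> Prop) :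
  P 0 -> (forall x y, P x -> P y -> P (x + y)) ->
  (forall x y, x \in U -> y \in W -> P (bracket x y)) ->
  forall v, v \in bracketv U W -> P v.
Proof.
move=> P0 PD PB v; rewrite /bracketv.
set s := (X in <<X>>%VS) => /(@coord_span _ _ _ (in_tuple s)) ->.
apply: (big_ind P) => // i _; have /= := mem_nth 0 (ltn_ord i).
case/allpairsP => - [x y] /= [xU yW ->]; rewrite -bracketZl.
by apply: PB; rewrite ?rpredZ // (vbasis_mem xU, vbasis_mem yW).
Qed.

(** For a maximal proper [M]-stable subspace [U], Engel's theorem on [M / U] yields [v] with
    [[M, v]] in [U]. Maximality gives [M = U + <[v]>], so [[M, M]] lies in [U]. *)
Lemma engel_proper M : subalg M -> M <> 0%VS ->
  (forall x y, x \in M -> y \in M -> exists k, iter k (bracket x) y = 0) ->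
  bracketv M M <> M.
Proof.
move=> sM M0 nilM.
have [|U [aU UM UnM] maxU] := @exists_max_dim L
    (fun U => [/\ acts_on M U, (U <= M)%VS & U <> M]).
  exists 0%VS; split; rewrite ?sub0v //; last by move=> /esym.
  by move=> x y _; rewrite !memv0 => /eqP ->; rewrite linear0.
have nMU : ~~ (M <= U)%VS.
  by apply/negP => MU; apply: UnM; apply/eqP; rewrite eqEsubv UM.
have [v [vM vU Mv]] : exists v,
    [/\ v \in M, v \notin U & forall x, x \in M -> bracket x v \in U].
  apply: engel => //.
  by move=> x y xM /(nilM _ _ xM)[k hk]; exists k; rewrite hk mem0v.
have eM : (U + <[v]>)%VS = M.
  apply: contrapT => neM.
  have /maxU : [/\ acts_on M (U + <[v]>)%VS, (U + <[v]> <= M)%VS & (U + <[v]>)%VS <> M].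
    split=> //; last by rewrite subv_add UM -memvE.
    move=> x _ xM /memv_addline[y yN [b ->]].
    apply: subvP (addvSl _ _) _ _; rewrite linearD linearZ /=.
    by apply: rpredD; [exact: aU | apply: rpredZ; exact: Mv].
  apply/negP; rewrite -ltnNge; apply: contraNltn vU => leN.
  have /eqP -> : U == (U + <[v]>)%VS by rewrite eqEdim addvSl.
  by apply: subvP (addvSr _ _) _ _; exact: memv_line.
move=> MM; move/negP: nMU; apply; rewrite -{1}MM.
apply/subvP; apply: bracketv_ind => [|x y|x y xM]; [exact: mem0v|exact: rpredD|].
rewrite -{1}eM => /memv_addline[u uU [a ->]]; rewrite linearD linearZ /=;
  apply: rpredD; [exact: aU | apply: rpredZ; exact: Mv].
Qed.

End Engel.

(** * The Killing form and Cartan's criterion *)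

Section Killing.
Import VectorInternalTheory.
Variables (F : fieldType) (L : lieAlgType F).
Implicit Types (x y z : L) (U V P : {vspace L}).

(* Matrices act on row vectors, so that [adm] reverses products. *)
Definition adm x : 'M[F]_(dim L) := lin1_mx (v2r \o bracket x \o r2v).

Lemma bracket_derivation x y z :
  bracket x (bracket y z) = bracket (bracket x y) z + bracket y (bracket x z).
Proof.
have /eqP := jacobi x y z; rewrite -addrA addr_eq0 => /eqP ->.
rewrite opprD [bracket z x]bracketC linearN opprK addrC; congr (_ + _).
by rewrite -bracketC.
Qed.

Lemma v2r_eq0 x : v2r x = 0 -> x = 0.
Proof. by move=> h; apply: v2r_inj; rewrite h linear0. Qed.

Lemma memv_v2r x U : (x \in U) = (v2r x <= vs2mx U)%MS.
Proof. by rewrite -genmxE. Qed.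

Lemma v2r_adm x u : v2r u *m adm x = v2r (bracket x u).
Proof. by rewrite mul_rV_lin1 /= v2rK. Qed.

Lemma v2r_eqmx (A B : 'M[F]_(dim L)) :
  (forall u, v2r u *m A = v2r u *m B) -> A = B.
Proof. by move=> H; apply/row_matrixP => i; rewrite !rowE -[delta_mx _ _]r2vK. Qed.

Lemma adm_is_linear : linear adm.
Proof.
move=> a x y; apply: v2r_eqmx => u.
by rewrite mulmxDr -scalemxAr !v2r_adm bracketDl bracketZl linearP.
Qed.
HB.instance Definition _ :=
  GRing.isLinear.Build F L 'M[F]_(dim L) _ adm adm_is_linear.

Lemma adm_bracket x y : adm (bracket x y) = adm y *m adm x - adm x *m adm y.
Proof.
apply: v2r_eqmx => u; rewrite mulmxBr !mulmxA !v2r_adm -linearB; congr v2r.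
apply/eqP; rewrite [bracket (bracket x y) u]bracketC [bracket x u]bracketC.
by rewrite linearN opprK eq_sym -addr_eq0 jacobi.
Qed.

Lemma v2r_iter x y k : v2r (iter k (bracket x) y) = v2r y *m adm x ^+ k.
Proof.
elim: k => [|k IH]; first by rewrite expr0 mulmx1.
by rewrite exprSr -mulmxE mulmxA -IH v2r_adm.
Qed.

Definition killing x y : F := \tr (adm x *m adm y).

Lemma killingC x y : killing x y = killing y x.
Proof. exact: mxtrace_mulC. Qed.

Lemma killing_is_linear x : linear (killing x : L -> F^o).
Proof.
move=> a y z; rewrite /killing (linearP adm) mulmxDr -scalemxAr.
exact: (linearP mxtrace).
Qed.
HB.instance Definition _ x :=
  GRing.isLinear.Build F L F^o _ (killing x : L -> F^o) (killing_is_linear x).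

Lemma killing_inv x y z : killing (bracket x y) z = killing x (bracket y z).
Proof.
rewrite /killing !adm_bracket mulmxBl mulmxBr !linearB /= !mulmxA.
by congr (_ - _); rewrite -[in LHS]mulmxA mxtrace_mulC.
Qed.

Lemma vspace_of_pred (V : vectType F) (A : V -> Prop) : A 0 ->
  (forall (a : F) (x y : V), A x -> A y -> A (a *: x + y)) ->
  exists W : {vspace V}, forall x : V, x \in W <-> A x.
Proof.
move=> A0 Alin; have [|W WA maxW] 
    := @exists_max_dim _ V (fun W => forall x : V, x \in W -> A x).
  by exists 0%VS => x; rewrite memv0 => /eqP ->.
exists W => x; split=> [|Ax]; first exact: WA.
have /maxW : forall y : V, y \in (W + <[x]>)%VS -> A y.
  move=> _ /memv_addP[u hu [_ /vlineP[a ->] ->]]; rewrite addrC.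
  by apply: Alin => //; exact: WA.
apply: contraTT => xW; rewrite -ltnNge ltnNge; apply: contra xW => leW.
have /eqP -> : W == (W + <[x]>)%VS by rewrite eqEdim addvSl.
by apply: subvP (addvSr _ _) _ _; exact: memv_line.
Qed.

Lemma bracket_ideal U V : ideal U -> ideal V -> ideal (bracketv U V).
Proof.
move=> iU iV x; apply: bracketv_ind => [|y z yB zB|u v uU vV].
- by rewrite linear0 mem0v.
- by rewrite linearD rpredD.
- have /eqP := jacobi x u v; rewrite -addrA addr_eq0 => /eqP ->.
  rewrite rpredN rpredD //.
    by apply: bracketvP => //; rewrite bracketC rpredN; exact: iV.
  by rewrite bracketC rpredN; apply: bracketvP => //; exact: iU.
Qed.

Lemma bracketv_subl U V : ideal U -> (bracketv U V <= U)%VS.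
Proof.
move=> iU; apply/subvP; apply: bracketv_ind => [|x y|x y xU _].
- exact: mem0v.
- exact: rpredD.
- by rewrite bracketC rpredN; exact: iU.
Qed.

(** The derived series consists of ideals and never reaches zero; its dimensions cannot drop
    forever, so some term equals its derived algebra. *)
Lemma perfect_core U : ideal U -> ~ solvable U -> exists P,
  [/\ ideal P, (P <= U)%VS, P <> 0%VS & bracketv P P = P].
Proof.
move=> iU nsU; pose D k := iter k (fun V => bracketv V V) U.
have iD k : ideal (D k) by elim: k => //= k IH; apply: bracket_ideal.
have DU k : (D k <= U)%VS.
  by elim: k => //= k IH; apply: subv_trans IH; exact: bracketv_subl.
have D0 k : D k <> 0%VS by move=> h; apply: nsU; exists k.
apply: contrapT => H.
have : forall k, (\dim (D k) + k <= \dim U)%N.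
  elim=> [|k IH]; first by rewrite addn0.
  rewrite addnS; apply: leq_trans IH; rewrite ltn_add2r ltnNge; apply/negP => le.
  apply: H; exists (D k); split=> //; apply/eqP; rewrite eqEdim le andbT.
  exact: bracketv_subl.
by move/(_ (\dim U).+1); rewrite addnS ltnNge leq_addl.
Qed.

(** Induction on [N + M] from the Leibniz rule: [ad p - (a + b)] sends [[u, v]] to
    [[(ad p - a) u, v] + [u, (ad p - b) v]]. *)
Lemma v2r_geneigen p a b N M u v :
  v2r u *m (adm p - a%:M) ^+ N = 0 -> v2r v *m (adm p - b%:M) ^+ M = 0 ->
  v2r (bracket u v) *m (adm p - (a + b)%:M) ^+ (N + M) = 0.
Proof.
have vz (w : L) : v2r w *m 1 = 0 -> w = 0.
  by rewrite mulmx1; exact: v2r_eq0.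
have [s] := ubnP (N + M); elim: s N M u v => // s IH [|N] [|M] u v; rewrite ?expr0.
- by move=> _ /vz -> _; rewrite bracket0l linear0 mul0mx.
- by move=> _ /vz -> _; rewrite bracket0l linear0 mul0mx.
- by move=> _ _ /vz ->; rewrite linear0 linear0 mul0mx.
rewrite addSn ltnS => les hu hv; rewrite exprS -mulmxE mulmxA.
have shift c w : v2r w *m (adm p - c%:M) = v2r (bracket p w - c *: w).
  by rewrite mulmxBr v2r_adm mul_mx_scalar (linearB v2r) (linearZ_LR v2r).
have -> : v2r (bracket u v) *m (adm p - (a + b)%:M) =
    v2r (bracket (bracket p u - a *: u) v) + v2r (bracket u (bracket p v - b *: v)).
  rewrite shift -linearD; congr v2r.
  have -> : bracket (bracket p u - a *: u) v = bracket (bracket p u) v - a *: bracket u v.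
    by rewrite -scaleNr bracketDl bracketZl scaleNr.
  rewrite (linearB (bracket u)) (linearZ_LR (bracket u)) (bracket_derivation p u v).
  by rewrite scalerDl opprD addrACA.
rewrite mulmxDl [X in X + _](IH N M.+1) ?add0r ?addnS.
- rewrite -addSn (IH N.+1 M) // ?addSn //.
    by rewrite -addnS.
  by rewrite -shift -mulmxA mulmxE -exprS.
- by rewrite -addnS.
- by rewrite -shift -mulmxA mulmxE -exprS.
- by [].
Qed.

End Killing.

Lemma comm_mx_shift (F : fieldType) n (A B : 'M[F]_n) c N :
  comm_mx B A -> comm_mx B ((A - c%:M) ^+ N).
Proof. by move=> h; apply: commrX; apply: commrB => //; exact: comm_mx_scalar. Qed.

(** By induction on [N], [w] is killed by [A - c]; then [(A - d) ^+ M] acts on it as the nonzero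
    scalar [(c - d) ^+ M]. *)
Lemma geneigen_disjoint (F : fieldType) n (A : 'M[F]_n) c d N M (w : 'rV_n) :
  c != d -> w *m (A - c%:M) ^+ N = 0 -> w *m (A - d%:M) ^+ M = 0 -> w = 0.
Proof.
move=> cd; elim: N w => [|N IH] w; first by rewrite expr0 mulmx1.
rewrite exprS -mulmxE mulmxA => hc hd.
have /IH/(_ _) : w *m (A - c%:M) *m (A - c%:M) ^+ N = 0 by [].
have comm : (A - c%:M) *m (A - d%:M) ^+ M = (A - d%:M) ^+ M *m (A - c%:M).
  apply: comm_mx_shift; apply: comm_mx_sym.
  by have := comm_mx_shift c 1 (erefl (A *m A)); rewrite expr1.
rewrite -mulmxA comm mulmxA hd mul0mx => /(_ erefl)/eqP.
rewrite mulmxBr subr_eq0 mul_mx_scalar => /eqP wA.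
have E k : w *m (A - d%:M) ^+ k = (c - d) ^+ k *: w.
  elim: k => [|k IHk]; first by rewrite !expr0 mulmx1 scale1r.
  rewrite exprSr -mulmxE mulmxA IHk -scalemxAl mulmxBr wA mul_mx_scalar -scalerBl.
  by rewrite scalerA exprSr.
move: hd; rewrite E => /eqP; rewrite scaler_eq0 expf_eq0 subr_eq0 (negPf cd) andbF.
by move=> /eqP.
Qed.

Section CartanCriterion.
Import VectorInternalTheory.
Variables (F : closedFieldType) (ch : [pchar F] =i pred0) (L : lieAlgType F).
Implicit Types (x y z : L) (U V P : {vspace L}).

Lemma mxtrace_geneigen n (A E : 'M[F]_n) c :
  E *m E = E -> comm_mx E A -> (A - c%:M) ^+ n *m E = 0 ->
  \tr (A *m E) = c * (\rank E)%:R.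
Proof.
move=> idE cEA h; rewrite -[A in A *m E](subrK c%:M) mulmxDl mxtraceD.
rewrite mul_scalar_mx mxtraceZ (mxtrace_idem idE).
have /mxtrace_nilp tr0 : ((A - c%:M) *m E) ^+ n.+1 = 0; last by rewrite tr0 add0r.
rewrite -[_ *m E]/(_ * E) exprMn_comm.
  rewrite exprS [E ^+ _]exprS -mulrA [X in _ * X]mulrA.
  by rewrite [_ ^+ n * E]h mul0r mulr0.
by apply: commr_sym; have := comm_mx_shift c 1 cEA; rewrite expr1.
Qed.

(** The alternative [E i = 0] is there because [spectral] does not assert that the projections are
    nonzero. *)
Lemma spectral_nilp n k (A : 'M[F]_n) (l : 'I_k -> F) E :
  \sum_i E i = 1%:M -> (forall i, (A - (l i)%:M) ^+ n *m E i = 0) ->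
  (forall i, l i = 0 \/ E i = 0) -> A ^+ n = 0.
Proof.
move=> sE hE h; rewrite -[LHS]mulmx1 -sE mulmx_sumr big1 // => i _.
case: (h i) => [l0|->]; last by rewrite mulmx0.
by have := hE i; rewrite l0 (raddf0 (@scalar_mx F n)) subr0.
Qed.

(** For [p = [a, b]] the trace is [- killing a (D b)], and [D b] is again in [P]. *)
Lemma mxtrace_derivation P (Y : 'M[F]_(dim L)) (D : L -> L) p :
  {in P &, forall x y, killing x y = 0} -> {in P, forall y, D y \in P} ->
  (forall x, adm (D x) = adm x *m Y - Y *m adm x) ->
  p \in bracketv P P -> \tr (adm p *m Y) = 0.
Proof.
move=> kP DP hD; move: p; apply: bracketv_ind => [|x y hx hy|a b aP bP].
- by rewrite linear0 mul0mx mxtrace0.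
- by rewrite linearD mulmxDl mxtraceD hx hy addr0.
rewrite adm_bracket mulmxBl linearB /= -mulmxA mxtrace_mulC -!mulmxA -linearB /=.
by rewrite -mulmxBr -opprB -hD mulmxN linearN /= -/(killing a _) kP ?DP // oppr0.
Qed.

(* With [E i] the generalised eigenprojections of [ad p] and [phi] dual to its
   eigenvalues, [Y = sum phi_i E_i] is a derivation preserving [P]; then
   [tr (ad p Y) = 0], and applying [phi] to [sum_i m_i phi_i l_i = 0] yields
   [sum_i m_i phi_i ^ 2 = 0], [m_i] being the multiplicities. *)
Lemma cartan_nilpotent P p : ideal P -> {in P &, forall x y, killing x y = 0} ->
  p \in bracketv P P -> adm p ^+ dim L = 0.
Proof.
move=> iP kP pP.
have [k [l [E [linj sE EE geE [comE stE]]]]] := spectral (adm p).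
apply: (spectral_nilp sE geE) => i; apply: contrapT => /not_orP[/eqP li0 /eqP Ei0].
(* Setting the value to 0 where [E i] vanishes makes the relation with single coefficient 1 at [i]
   hold, which forces [phi i = 0]. *)
pose l' i := if E i == 0 then 0 else l i.
have l'i0 : l' i != 0 by rewrite /l' (negPf Ei0).
have [phi [i1 phi0] hphi] := rational_dual ch l'i0.
have sum1 (j : 'I_k) (f : 'I_k -> F) : \sum_i (i == j)%:R%:~R * f i = f j.
  rewrite (bigD1 j) //= eqxx mul1r big1 ?addr0 // => a /negPf ->.
  by rewrite mul0r.
have sum1' (j : 'I_k) (f : 'I_k -> int) : \sum_i (i == j)%:R * f i = f j.
  rewrite (bigD1 j) //= eqxx mul1r big1 ?addr0 // => a /negPf ->.
  by rewrite mul0r.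
have phiE j : E j = 0 -> phi j = 0.
  move=> Ej; rewrite -(sum1' j phi); apply: hphi; rewrite sum1.
  by rewrite /l' Ej eqxx.
have phiD a b c : E a != 0 -> E b != 0 -> E c != 0 -> l c = l a + l b ->
    phi c = phi a + phi b.
  move=> Ea Eb Ec lc; apply/eqP; rewrite -subr_eq0 opprD addrA.
  have : \sum_j ((j == c)%:R - (j == a)%:R - (j == b)%:R) * phi j = 0.
    apply: hphi.
    rewrite (eq_bigr (fun j => (j == c)%:R%:~R * l' j - (j == a)%:R%:~R * l' j
      - (j == b)%:R%:~R * l' j)) => [|j _]; last by rewrite !rmorphB /= !mulrBl.
    rewrite !sumrB !sum1 /l' (negPf Ea) (negPf Eb) (negPf Ec) lc.
    by rewrite -addrA -opprD subrr.
  rewrite (eq_bigr (fun j => (j == c)%:R * phi j - (j == a)%:R * phi j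
      - (j == b)%:R * phi j)) => [|j _]; last by rewrite !mulrBl.
  by rewrite !sumrB !sum1' => ->.
pose Y : 'M[F]_(dim L) := \sum_j (phi j)%:~R *: E j.
pose D x : L := r2v (v2r x *m Y).
have DP : {in P, forall y, D y \in P}.
  move=> y yP; rewrite /D memv_v2r r2vK mulmx_sumr summx_sub // => j _.
  rewrite -scalemxAr scalemx_sub //.
  have st : (vs2mx P *m adm p <= vs2mx P)%MS.
    apply/row_subP => r; rewrite row_mul -[row r _]r2vK v2r_adm -memv_v2r.
    by apply: iP; rewrite memv_v2r r2vK row_sub.
  by apply: submx_trans (stE j _ _ st); apply: submxMr; rewrite -memv_v2r.
have comA j c N : (adm p - c%:M) ^+ N *m E j = E j *m (adm p - c%:M) ^+ N.
  by apply/esym/comm_mx_shift/comE.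
have hD x : adm (D x) = adm x *m Y - Y *m adm x.
  (* The bracket of generalised eigenvectors for [l a] and [l b] has components only at those [c]
     with [l c = l a + l b], where [phi c = phi a + phi b]. *)
  have gen u v a b : v2r u *m E a = v2r u -> v2r v *m E b = v2r v ->
      v2r (bracket u v) *m Y = ((phi a)%:~R + (phi b)%:~R) *: v2r (bracket u v).
    move=> ua vb; rewrite -[v2r (bracket u v) in RHS]mulmx1 -sE !mulmx_sumr scaler_sumr.
    apply: eq_bigr => c _; rewrite -scalemxAr.
    have [->|w0] := eqVneq (v2r (bracket u v) *m E c) 0; first by rewrite !scaler0.
    rewrite (phiD a b c) ?rmorphD //.
    - apply: contraNneq w0 => Ea; move: ua; rewrite Ea mulmx0 => /esym/v2r_eq0 ->.
      by rewrite bracket0l linear0 mul0mx.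
    - apply: contraNneq w0 => Eb; move: vb; rewrite Eb mulmx0 => /esym/v2r_eq0 ->.
      by rewrite linear0 linear0 mul0mx.
    - by apply: contraNneq w0 => ->; rewrite mulmx0.
    apply: contraNeq w0 => lc; apply/eqP.
    apply: (geneigen_disjoint lc (N := dim L) (M := dim L + dim L) (A := adm p)).
      by rewrite -mulmxA -comA geE mulmx0.
    rewrite -mulmxA -comA mulmxA v2r_geneigen ?mul0mx //.
      by rewrite -ua -mulmxA -comA geE mulmx0.
    by rewrite -vb -mulmxA -comA geE mulmx0.
  apply: v2r_eqmx => w; apply/eqP; rewrite mulmxBr !mulmxA eq_sym subr_eq eq_sym v2r_adm.
  pose pE j y : L := r2v (v2r y *m E j).
  have pEE j y : v2r (pE j y) *m E j = v2r (pE j y).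
    by rewrite r2vK -mulmxA EE eqxx.
  have dec y : y = \sum_j pE j y.
    by rewrite /pE -linear_sum -mulmx_sumr sE mulmx1 /= v2rK.
  have YE j y : v2r (pE j y) *m Y = (phi j)%:~R *: v2r (pE j y).
    rewrite mulmx_sumr (bigD1 j) //= -scalemxAr pEE big1 ?addr0 // => a aj.
    by rewrite -scalemxAr r2vK -mulmxA EE eq_sym (negPf aj) mulmx0 scaler0.
  have -> : D x = \sum_a (phi a)%:~R *: pE a x.
    rewrite /D [x in LHS]dec (linear_sum v2r) /= mulmx_suml (linear_sum r2v) /=.
    by apply: eq_bigr => a _; rewrite YE (linearZ_LR r2v) /= v2rK.
  have -> : v2r w *m Y = \sum_b (phi b)%:~R *: v2r (pE b w).
    rewrite [w in LHS]dec (linear_sum v2r) /= mulmx_suml.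
    by apply: eq_bigr => b _; exact: YE.
  have brw u : bracket u w = \sum_b bracket u (pE b w).
    by rewrite [w in LHS]dec (linear_sum (bracket u)).
  have brx v : bracket x v = \sum_a bracket (pE a x) v.
    by rewrite [x in LHS]dec bracket_suml.
  rewrite v2r_adm !brw !(linear_sum v2r) /= !mulmx_suml -big_split /=.
  apply/eqP/eq_bigr => b _; rewrite -scalemxAl v2r_adm brx bracket_suml.
  rewrite !(linear_sum v2r) /= scaler_sumr mulmx_suml -big_split /=.
  apply: eq_bigr => a _; rewrite bracketZl (linearZ_LR v2r) /= -scalerDl.
  by apply/esym/gen.
have := mxtrace_derivation kP DP hD pP.
rewrite mulmx_sumr linear_sum /=.
rewrite (eq_bigr (fun j => (phi j * (\rank (E j))%:Z)%:~R * l' j)); last first.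
  move=> j _; rewrite -scalemxAr linearZ /= (@mxtrace_geneigen _ _ _ (l j)) //.
  - rewrite intrM /l' -mulrA; congr (_ * _); rewrite mulrC.
    by case: eqP => [->|]; rewrite ?mxrank0 ?mul0r ?mulr0.
  - by rewrite EE eqxx.
  - exact: comE.
move/hphi/eqP; rewrite psumr_eq0 => [/allP/(_ i1)|j _]; last first.
  by rewrite mulrAC mulr_ge0 // -expr2 sqr_ge0.
rewrite mem_index_enum => /(_ isT); rewrite /= !mulf_eq0 (negPf phi0) /= orbF.
rewrite -[0]/(0%:Z) eqz_nat mxrank_eq0 => /eqP/phiE h; by rewrite h eqxx in phi0.
Qed.

(** If the radical of the form were not solvable, it would contain a nonzero ideal [P = [P, P]]. All
    elements of [P] are ad-nilpotent by [cartan_nilpotent], which [engel_proper] forbids. *)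
Lemma killing_nondegenerate : semisimple L ->
  forall x, (forall y, killing x y = 0) -> x = 0.
Proof.
move=> ss; have [|a x y hx hy z|R hR] 
    := @vspace_of_pred _ L (fun x => forall y, killing x y = 0).
- by move=> y; rewrite killingC linear0.
- by rewrite killingC linearP /= killingC hx killingC hy scaler0 addr0.
have iR : ideal R.
  move=> x y /hR yR; apply/hR => z; rewrite killingC -killing_inv killingC.
  exact: yR.
suff R0 : R = 0%VS by move=> x /hR; rewrite R0 memv0 => /eqP.
apply: ss => //; apply: contrapT => /(perfect_core iR)[P [iP PR P0 PP]].
have kP : {in P &, forall x y, killing x y = 0}.
  by move=> x y /(subvP PR)/hR.
apply: (engel_proper _ P0 _ PP) => [x y _|x y xP _]; first exact: iP.
exists (dim L); apply: v2r_inj; rewrite v2r_iter (cartan_nilpotent iP kP) ?PP //.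
by rewrite mulmx0 linear0.
Qed.

End CartanCriterion.

(** * Nilspaces, rank and centralisers *)

Section MatrixPowers.

(** The rank of [A ^+ i] cannot drop at each [i <= n]; once two consecutive powers have equal rank,
    their kernels agree and stay constant. *)
Lemma mxpow_stationary (F : fieldType) n (A : 'M[F]_n) k (v : 'rV_n) :
  v *m A ^+ k = 0 -> v *m A ^+ n = 0.
Proof.
have [i lein eqr] : exists2 i, (i <= n)%N & \rank (A ^+ i.+1) = \rank (A ^+ i).
  apply: contrapT => H.
  have : forall i, (i <= n.+1)%N -> (\rank (A ^+ i) + i <= n)%N.
    elim=> [|i IH] lei; first by rewrite addn0 rank_leq_row.
    rewrite addnS; apply: leq_trans (IH (ltnW lei)); rewrite ltn_add2r ltn_neqAle.
    rewrite {2}exprS mxrankM_maxr andbT; apply/eqP => e; apply: H; exists i => //.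
  by move/(_ n.+1 (leqnn _)); rewrite addnS ltnNge leq_addl.
have step (u : 'rV_n) : u *m A ^+ i.+1 = 0 -> u *m A ^+ i = 0.
  have sub : (kermx (A ^+ i) <= kermx (A ^+ i.+1))%MS.
    by apply/sub_kermxP; rewrite exprSr -mulmxE mulmxA mulmx_ker mul0mx.
  have sup : (kermx (A ^+ i.+1) <= kermx (A ^+ i))%MS.
    by rewrite -(mxrank_leqif_sup sub).2 !mxrank_ker eqr.
  by move/sub_kermxP => /submx_trans/(_ sup)/sub_kermxP.
have down j (u : 'rV_n) : u *m A ^+ (j + i) = 0 -> u *m A ^+ i = 0.
  elim: j u => // j IH u; rewrite addSn exprS -mulmxE mulmxA => /IH.
  by rewrite -mulmxA mulmxE -exprS => /step.
move=> vk; have /down vi : v *m A ^+ (k + i) = 0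
  by rewrite exprD -mulmxE mulmxA vk mul0mx.
have -> : A ^+ n = A ^+ i *m A ^+ (n - i) by rewrite mulmxE -exprD subnKC.
by rewrite mulmxA vi mul0mx.
Qed.

(** Fitting's decomposition into kernel and image of [A ^+ n], since [A ^+ (n + n)] and [A ^+ n]
    have the same row space. *)
Lemma mxpow_fitting (F : fieldType) n (A : 'M[F]_n) (w : 'rV_n) :
  exists u : 'rV_n, (w - u *m A ^+ n) *m A ^+ n = 0.
Proof.
have sub : (A ^+ (n + n) <= A ^+ n)%MS by rewrite exprD submxMl.
have /submxP[u hu] : (w *m A ^+ n <= A ^+ (n + n))%MS.
  apply: submx_trans (submxMl _ _) _.
  rewrite -(mxrank_leqif_sup sub).2 eqn_leq (mxrankS sub) /=.
  have kk : (kermx (A ^+ (n + n)) <= kermx (A ^+ n))%MS.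
    apply/row_subP => i; apply/sub_kermxP; apply: (@mxpow_stationary _ _ _ (n + n)).
    by rewrite -row_mul mulmx_ker row0.
  have := mxrankS kk; rewrite !mxrank_ker leq_sub2lE //; exact: rank_leq_row.
by exists u; rewrite mulmxBl hu exprD -mulmxE mulmxA subrr.
Qed.

Definition pencil (F : fieldType) n (A B : 'M[F]_n) : 'M[{poly F}]_n :=
  map_mx polyC A + 'X *: map_mx polyC B.

Lemma pencilE (F : fieldType) n (A B : 'M[F]_n) t :
  map_mx (horner_eval t) (pencil A B) = A + t *: B.
Proof. by apply/matrixP => i j; rewrite !mxE /horner_eval !hornerE. Qed.

Lemma map_horner_exp (F : fieldType) n (M : 'M[{poly F}]_n) k (t : F) :
  map_mx (horner_eval t) (M ^+ k) = map_mx (horner_eval t) M ^+ k.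
Proof.
elim: k => [|k IH]; first by rewrite !expr0 map_mx1.
by rewrite !exprS -!mulmxE map_mxM IH.
Qed.

End MatrixPowers.

Section Rank.
Import VectorInternalTheory.
Variables (F : fieldType) (L : lieAlgType F).
Implicit Types (x y z : L) (U V : {vspace L}).
Local Notation n := (dim L).

Definition kerv (M : 'M[F]_n) : {vspace L} := mx2vs (kermx M).

Lemma mem_kerv M y : (y \in kerv M) = (v2r y *m M == 0).
Proof. by rewrite memv_v2r mx2vsK; apply/sub_kermxP/eqP. Qed.

Lemma dim_kerv M : \dim (kerv M) = (n - \rank M)%N.
Proof. by rewrite /dimv mx2vsK mxrank_ker. Qed.

Lemma centraliserE x : centraliser x = kerv (adm x).
Proof.
apply/vspaceP => y; rewrite memv_ker lfunE mem_kerv v2r_adm.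
by apply/eqP/eqP => [->|/v2r_eq0 //]; rewrite linear0.
Qed.

Lemma nilspaceE x : nilspace x = kerv (adm x ^+ n).
Proof.
apply/vspaceP => y; rewrite mem_kerv -v2r_iter /nilspace dimvf.
have -> : (v2r (iter n (bracket x) y) == 0) = (iter n (bracket x) y == 0).
  by apply/eqP/eqP => [/v2r_eq0 //|->]; rewrite linear0.
move: {1 2}n => k; elim: k y => [|k IH] y; first by rewrite memv0.
by rewrite [in LHS]iterS -memv_preim IH lfunE /= -iterSr.
Qed.

Lemma mem_nilspace x y k : v2r y *m adm x ^+ k = 0 -> y \in nilspace x.
Proof. by rewrite nilspaceE mem_kerv => /mxpow_stationary ->. Qed.

Lemma nilspaceP x y : y \in nilspace x -> v2r y *m adm x ^+ n = 0.
Proof. by rewrite nilspaceE mem_kerv => /eqP. Qed.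

Lemma nilspace_id x : x \in nilspace x.
Proof. by apply: (@mem_nilspace _ _ 1); rewrite v2r_adm bracketxx linear0. Qed.

Lemma nilspace_subalg x : subalg (nilspace x).
Proof.
move=> u v /nilspaceP hu /nilspaceP hv; apply: (@mem_nilspace _ _ (n + n)).
have := @v2r_geneigen _ _ x 0 0 n n u v.
by rewrite addr0 (raddf0 (@scalar_mx F n)) subr0; apply.
Qed.

Lemma rank_le_nilspace x : (rank L <= \dim (nilspace x))%N.
Proof.
rewrite /rank; case: ex_minnP => r _; apply.
by apply/asboolP; exists x.
Qed.

Lemma rank_nilspace : exists x : L, \dim (nilspace x) = rank L.
Proof. by rewrite /rank; case: ex_minnP => r /asboolP. Qed.

Lemma adm_pencil x z t : adm (x + t *: z) = adm x + t *: adm z.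
Proof. by rewrite linearD linearZ. Qed.

Lemma nilspace_open x z t0 : exists2 p : {poly F}, p.[t0] != 0 &
  forall t, p.[t] != 0 ->
    (\dim (nilspace (x + t *: z)%R) <= \dim (nilspace (x + t0 *: z)%R))%N.
Proof.
have [p p0 hp] := rank_open (pencil (adm x) (adm z) ^+ n) t0; exists p => // t /hp.
by rewrite !nilspaceE !dim_kerv !map_horner_exp !pencilE -!adm_pencil; exact: leq_sub2l.
Qed.

Lemma centraliser_open x z t0 : exists2 p : {poly F}, p.[t0] != 0 &
  forall t, p.[t] != 0 ->
    (\dim (centraliser (x + t *: z)%R) <= \dim (centraliser (x + t0 *: z)%R))%N.
Proof.
have [p p0 hp] := rank_open (pencil (adm x) (adm z)) t0; exists p => // t /hp.
by rewrite !centraliserE !dim_kerv !pencilE -!adm_pencil; exact: leq_sub2l.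
Qed.

(* For generic [t] the element [h + t (x - h)] of [nilspace h] acts invertibly
   on [L / nilspace h], so that its nilspace is [nilspace h] by minimality. *)
Lemma nilspace_engel h : [pchar F] =i pred0 -> \dim (nilspace h) = rank L ->
  forall x y, x \in nilspace h -> y \in nilspace h -> y \in nilspace x.
Proof.
move=> ch dimH x y; set H := nilspace h => xH yH.
pose z := x - h; pose xt t := h + t *: z.
have xtH t : xt t \in H by rewrite rpredD ?rpredZ ?rpredB ?nilspace_id.
(* Multiplication by [C] is passage to the quotient by [H]. *)
pose C := cokermx (vs2mx H).
have memH u : (u \in H) = (v2r u *m C == 0) by rewrite memv_v2r submxE.
pose M := pencil (adm h *m C) (adm z *m C).
have hM t : map_mx (horner_eval t) M = adm (xt t) *m C.
  by rewrite pencilE adm_pencil mulmxDl scalemxAl.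
have memM t u : (u \in kerv (adm (xt t) *m C)) = (bracket (xt t) u \in H).
  by rewrite mem_kerv memH mulmxA v2r_adm.
have kerM0 : kerv (adm (xt 0) *m C) = H.
  apply/vspaceP => u; rewrite memM /xt scale0r addr0; apply/idP/idP.
    move/nilspaceP => hu; apply: (@mem_nilspace _ _ n.+1).
    by rewrite exprS -mulmxE mulmxA v2r_adm.
  by move=> uH; apply: nilspace_subalg => //; exact: nilspace_id.
have [p p0 hp] := rank_open M 0.
have pn0 : p != 0 by apply: contraNneq p0 => ->; rewrite horner0.
have gen t : p.[t] != 0 -> v2r y *m adm (xt t) ^+ n = 0.
  move/hp; rewrite !hM => /(leq_sub2l n); rewrite -!dim_kerv kerM0 => le_dim.
  have kerMt : H = kerv (adm (xt t) *m C).
    apply/eqP; rewrite eqEdim le_dim andbT; apply/subvP => u uH.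
    by rewrite memM; apply: nilspace_subalg.
  (* As [ad (xt t)] is injective modulo [H], an element killed by one of its powers lies in [H]. *)
  have sub : (nilspace (xt t) <= H)%VS.
    apply/subvP => u /nilspaceP; rewrite -v2r_iter => /v2r_eq0.
    elim: {1}n u => [|k IH] u /=; first by move=> ->; rewrite mem0v.
    by rewrite -iterS iterSr => /IH; rewrite -memM -kerMt.
  apply: nilspaceP; suff /eqP -> : nilspace (xt t) == H by [].
  by rewrite eqEdim sub dimH rank_le_nilspace.
(* The value 1 may be a root of [p]; the vanishing is carried over to it because each entry is
   polynomial in [t]. *)
have -> : x = xt 1 by rewrite /xt scale1r addrC subrK.
rewrite nilspaceE mem_kerv; apply/eqP/matrixP => i j; rewrite [RHS]mxE.
pose Q := map_mx polyC (v2r y) *m pencil (adm h) (adm z) ^+ n.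
have hQ t : (Q i j).[t] = (v2r y *m adm (xt t) ^+ n) i j.
  rewrite adm_pencil -pencilE -map_horner_exp.
  have -> : v2r y = map_mx (horner_eval t) (map_mx polyC (v2r y)).
    by apply/matrixP => a b; rewrite !mxE /horner_eval hornerC.
  by rewrite -map_mxM [RHS]mxE.
rewrite -hQ (_ : Q i j = 0) ?horner0 //.
by apply: (poly_eq0_cofinite ch pn0) => t /gen; rewrite hQ => ->; rewrite mxE.
Qed.

Lemma killing_iter h k x u :
  iter k (bracket h) x = 0 -> killing x (iter k (bracket h) u) = 0.
Proof.
elim: k x u => [|k IH] x u; first by move=> /= ->; rewrite killingC linear0.
rewrite iterSr => /IH e; rewrite iterS -killing_inv bracketC.
rewrite -scaleN1r killingC linearZ /=.
by rewrite killingC e scaler0.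
Qed.

(** By Fitting, [L] is spanned by [nilspace h] and the image of a power of [ad h], and
    [killing_iter] makes the latter orthogonal to [nilspace h]. *)
Lemma killing_nilspace h x : (forall x, (forall y, killing x y = 0) -> x = 0) ->
  x \in nilspace h -> (forall y, y \in nilspace h -> killing x y = 0) -> x = 0.
Proof.
move=> nd xH kH; apply: nd => w.
have [u] := mxpow_fitting (adm h) (v2r w); rewrite -[u]r2vK -v2r_iter -linearB.
move/mem_nilspace => /kH; rewrite linearB /= killing_iter ?subr0 //.
by apply: v2r_eq0; rewrite v2r_iter; apply: nilspaceP.
Qed.

End Rank.

(** * Commutativity of minimal nilspaces and of regular centralisers *)

Section RegularElements.
Import VectorInternalTheory.
Variables (F : closedFieldType) (ch : [pchar F] =i pred0) (L : lieAlgType F).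
Hypothesis ss : semisimple L.
Implicit Types (x y z : L) (U V : {vspace L}).
Local Notation n := (dim L).

Lemma mxtrace_bracketv U (E : 'M[F]_n) c :
  (forall x, x \in U -> comm_mx (adm x) E) -> c \in bracketv U U ->
  \tr (adm c *m E) = 0.
Proof.
move=> cE; move: c; apply: bracketv_ind => [|x y hx hy|a b aU bU].
- by rewrite linear0 mul0mx mxtrace0.
- by rewrite linearD mulmxDl mxtraceD hx hy addr0.
rewrite adm_bracket mulmxBl linearB /= -mulmxA mxtrace_mulC -mulmxA -(cE b bU).
by rewrite mulmxA subrr.
Qed.

Lemma nilspace_abelian h : \dim (nilspace h) = rank L ->
  forall x y, x \in nilspace h -> y \in nilspace h -> bracket x y = 0.
Proof.
move=> dimH; set H := nilspace h => x y xH yH; apply: contrapT => xy0.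
have sH : subalg H by exact: nilspace_subalg.
pose B := bracketv H H.
have BH : forall v, v \in B -> v \in H.
  apply: bracketv_ind => [|u w|u w uH wH]; [exact: mem0v|exact: rpredD|exact: sH].
have nilH u w : u \in H -> w \in H -> exists k, iter k (bracket u) w = 0.
  move=> uH wH; exists n; apply: v2r_eq0; rewrite v2r_iter; apply: nilspaceP.
  exact: nilspace_engel uH wH.
(* Engel's theorem for [H] acting on [[H, H]], which is nonzero by assumption, gives a central [c].
   Its eigenprojections commute with [ad H], so the traces that compute [l i] times the rank of
   [E i] vanish. *)
have [c [cB c0 Hc]] : exists c, [/\ c \in B, c \notin (0%VS : {vspace L}) &
    forall u, u \in H -> bracket u c \in (0%VS : {vspace L})].
  apply: (engel (M := H)) => //.
  - by move=> u w uH /BH wH; exact: bracketvP.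
  - by move=> u w _; rewrite !memv0 => /eqP ->; rewrite linear0.
  - exact: sub0v.
  - by apply/negP => /subvP/(_ _ (bracketvP xH yH)); rewrite memv0 => /eqP.
  - by move=> u w uH /BH /(nilH _ _ uH)[k hk]; exists k; rewrite hk mem0v.
have com u : u \in H -> comm_mx (adm c) (adm u).
  move=> /Hc; rewrite memv0 => /eqP uc; apply/eqP; rewrite -subr_eq0.
  by rewrite -adm_bracket uc linear0.
have [k [l [E [_ sE EE geE [comE _]]]]] := spectral (adm c).
have nilc : adm c ^+ n = 0.
  apply: (spectral_nilp sE geE) => i.
  have : \tr (adm c *m E i) = 0.
    by apply: (mxtrace_bracketv _ cB) => u uH; apply/esym/comE/com.
  rewrite (@mxtrace_geneigen _ _ _ _ (l i)) ?EE ?eqxx //; last exact: comE.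
  move/eqP; rewrite mulf_eq0 pchar0_natr // mxrank_eq0.
  by case/orP => /eqP; [left | right].
move/negP: c0; apply; rewrite memv0; apply/eqP.
apply: (killing_nilspace (killing_nondegenerate ch ss) (BH _ cB)) => u uH.
apply: (@mxtrace_nilp _ _ _ n).
by rewrite -[_ *m _]/(_ * _) exprMn_comm ?nilc ?mul0r //; exact: com.
Qed.

(** At a generic point of the line through [h] and [x] the nilspace has minimal dimension, hence is
    commutative and lies in the centraliser of that point, which is no larger than the centraliser
    of [x]. *)
Lemma rank_le_centraliser x : (rank L <= \dim (centraliser x))%N.
Proof.
have [h dimh] := rank_nilspace L.
have [p p0 hp] := nilspace_open h (x - h) 0.
have [q q0 hq] := centraliser_open h (x - h) 1.
have [t] : exists t, (p * q).[t] != 0.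
  apply: poly_nonroot => //; rewrite mulf_neq0 //.
    by apply: contraNneq p0 => ->; rewrite horner0.
  by apply: contraNneq q0 => ->; rewrite horner0.
rewrite hornerM mulf_eq0 negb_or => /andP[/hp + /hq].
rewrite scale0r addr0 scale1r [h + (x - h)]addrC subrK dimh => le1.
apply: leq_trans; apply: leq_trans (rank_le_nilspace (h + t *: (x - h))) _.
apply/dimvS/subvP => y yH; rewrite memv_ker lfunE /=; apply/eqP.
apply: (nilspace_abelian _ _ yH); last exact: nilspace_id.
by apply/eqP; rewrite eqn_leq le1 rank_le_nilspace.
Qed.

Lemma centraliser_abelian x y z : regular x ->
  bracket x y = 0 -> bracket x z = 0 -> bracket y z = 0.
Proof.
move=> rx xy xz; apply: (killing_nondegenerate ch ss) => w; rewrite killingC.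
have le_r t : (\rank (adm x + t *: adm w)%R <= \rank (adm x))%N.
  rewrite -adm_pencil; have := rank_le_centraliser (x + t *: w); rewrite -rx.
  by rewrite !centraliserE !dim_kerv leq_sub2lE //; exact: rank_leq_row.
have /submxP[u hu] : (v2r y *m adm w <= adm x)%MS.
  by apply: (rank_tangent ch le_r); rewrite v2r_adm xy linear0.
have {}hu : bracket w y = bracket x (r2v u).
  by apply: v2r_inj; rewrite -!v2r_adm r2vK.
rewrite -killing_inv hu killingC -killing_inv -[bracket z x]opprK -bracketC xz.
by rewrite oppr0 killingC linear0.
Qed.

End RegularElements.

(** * Polynomial functions on the dual *)

Section Polynomials.
Variables (F : fieldType) (n : nat).
Implicit Types (f g : {mpoly F[n]}) (v w : 'I_n -> F).

Lemma mpoly_ring_ind (P : {mpoly F[n]} -> Prop) :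
  (forall c, P c%:MP) -> (forall i, P 'X_i) ->
  (forall f g, P f -> P g -> P (f + g)) ->
  (forall f g, P f -> P g -> P (f * g)) -> forall f, P f.
Proof.
move=> PC PX PD PM; elim/mpolyind => [|c m p _ _ Pp]; first exact: (PC 0).
apply: PD => //; rewrite -mul_mpolyC; apply: (PM) => //; rewrite mpolyXE_id.
apply: (big_ind P) => [|f g|i _]; [exact: (PC 1) | exact: PM |].
by elim: (m i) => [|k IH]; [exact: (PC 1) | rewrite exprS; apply: PM].
Qed.

Lemma mderivXU i j : mderiv i ('X_j : {mpoly F[n]}) = (j == i)%:R%:MP.
Proof.
rewrite mderivX mnm1E; case: eqVneq => [->|_]; last by rewrite scale0r mpolyC0.
rewrite scale1r -[RHS](mpolyX0 n F); congr mpolyX.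
by apply/mnmP => k; rewrite mnmBE subnn mnm0E.
Qed.

Definition mline f v w : {poly F} := mmap polyC (fun i => (v i)%:P + w i *: 'X) f.

Lemma horner_mline f v w t : (mline f v w).[t] = meval (fun i => v i + t * w i) f.
Proof.
rewrite /mline; elim/mpoly_ring_ind: f => [c|i|f g|f g].
- by rewrite mmapC hornerC mevalC.
- by rewrite mmapX mmap1U mevalXU !hornerE mulrC.
- by rewrite mmapD hornerD mevalD => -> ->.
- by rewrite rmorphM /= hornerM mevalM => -> ->.
Qed.

Lemma deriv_mline f v w :
  (mline f v w)^`() = \sum_i (w i)%:P * mline (mderiv i f) v w.
Proof.
rewrite /mline; elim/mpoly_ring_ind: f => [c|i|f g|f g].
- by rewrite mmapC derivC big1 // => i _; rewrite mderivC mmap0 mulr0.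
- rewrite mmapX mmap1U derivD derivC derivZ derivX add0r (bigD1 i) //= big1 => [|j ji].
    by rewrite mderivXU eqxx mmapC mulr1 addr0 alg_polyC.
  by rewrite mderivXU eq_sym (negPf ji) mmapC mulr0.
- rewrite mmapD derivD => -> ->; rewrite -big_split /=.
  by apply: eq_bigr => i _; rewrite mderivD mmapD mulrDr.
- rewrite rmorphM /= derivM => -> ->; rewrite mulr_suml mulr_sumr -big_split /=.
  apply: eq_bigr => i _; rewrite mderivM mmapD !rmorphM /= mulrDr -mulrA.
  by congr (_ + _); exact: mulrCA.
Qed.

Lemma deriv_eq0 : [pchar F] =i pred0 ->
  forall p : {poly F}, p^`() = 0 -> p = (p`_0)%:P.
Proof.
move=> ch p dp; apply/polyP => - [|i]; rewrite coefC //=.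
have /eqP := congr1 (fun q : {poly F} => q`_i) dp; rewrite coef_deriv coef0.
by rewrite -mulr_natr mulf_eq0 pchar0_natr // orbF => /eqP.
Qed.

Lemma poly_eq0_fun : [pchar F] =i pred0 ->
  forall p : {poly F}, (forall t, p.[t] = 0) -> p = 0.
Proof. by move=> ch p hp; apply: (poly_eq0_cofinite ch (oner_neq0 _)). Qed.

(** Induction on the degree of the monomial: the constant coefficient is the value at 0, and any
    other is, up to a nonzero integer, a coefficient of a partial derivative, which also vanishes at
    all points. *)
Lemma meval_eq0 : [pchar F] =i pred0 ->
  forall f, (forall v, meval v f = 0) -> f = 0.
Proof.
move=> ch f hf; apply/mpolyP => m; rewrite mcoeff0.
have [k] := ubnP (mdeg m); elim: k m f hf => // k IH m f hf /ltnSE lek.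
have [m0|m0] := eqVneq (mdeg m) 0%N.
  move/eqP: m0; rewrite mdeg_eq0 => /eqP ->; rewrite -(hf (fun=> 0)).
  elim/mpoly_ring_ind: f {hf} => [c|i|f g|f g].
  - by rewrite mcoeffC eqxx mulr1 mevalC.
  - by rewrite mcoeffX mevalXU; case: eqP => // /(congr1 mdeg); rewrite mdeg1 mdeg0.
  - by rewrite mcoeffD mevalD => -> ->.
  - by rewrite (mcoeff0_is_multiplicative n F).1 mevalM => -> ->.
have [i mi] : exists i, m i != 0%N.
  apply: contrapT => H; move/eqP: m0; apply; apply/eqP; rewrite mdeg_eq0.
  apply/eqP/mnmP => i; rewrite mnm0E; apply/eqP; apply: contra_notT H => mi.
  by exists i.
have mE : m = (m - U_(i) + U_(i))%MM by rewrite submK // lep1mP.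
have : (mderiv i f)@_(m - U_(i)) = 0.
  apply: IH => [v|].
    pose w j : F := (j == i)%:R.
    have line0 : mline f v w = 0.
      by apply: poly_eq0_fun => // t; rewrite horner_mline.
    have := congr1 (fun p : {poly F} => p.[0]) (deriv_mline f v w).
    rewrite line0 deriv0 horner0 horner_sum (bigD1 i) //= big1 => [|j /negPf ji].
      rewrite addr0 /w eqxx mul1r horner_mline => ->.
      by apply: meval_eq => j; rewrite mul0r addr0.
    by rewrite /w ji mul0r horner0.
  by apply: leq_trans lek; rewrite {2}mE mdegD mdeg1 addn1.
rewrite mcoeff_deriv -mE => /eqP; rewrite -mulr_natr mulf_eq0 pchar0_natr // orbF.
by move/eqP.
Qed.

End Polynomials.

(** * Poisson bracket and coadjoint exponentials on polynomial functions *)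

Section LiePolynomials.
Variables (F : fieldType) (ch : [pchar F] =i pred0) (L : lieAlgType F).
Implicit Types (x y : L) (f g : symAlg L) (xi : 'Hom(L, F^o)).

Lemma dual_point (v : 'I_(\dim {:L}) -> F) :
  exists xi : 'Hom(L, F^o), forall i, xi (lbase i) = v i.
Proof.
exists (\sum_i v i *: linfun (coord (vbasis {:L}) i : L -> F^o)) => i.
rewrite sum_lfunE (bigD1 i) //= big1 => [|j ji].
  rewrite addr0 scale_lfunE lfunE /= coord_free ?eqxx ?(basis_free (vbasisP _)) //.
  exact: mulr1.
rewrite scale_lfunE lfunE /= coord_free ?(basis_free (vbasisP _)) //.
by rewrite eq_sym (negPf ji); exact: mulr0.
Qed.

Lemma peval_eq0 f : (forall xi, peval f xi = 0) -> f = 0.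
Proof.
move=> hf; apply: (meval_eq0 ch) => v; have [xi hxi] := dual_point v.
by rewrite -(hf xi); apply: meval_eq => i; rewrite hxi.
Qed.

Lemma pdiff_sym_of x xi : pdiff (sym_of x) xi = x.
Proof.
rewrite [RHS](coord_vbasis (memvf x)); apply: eq_bigr => i _; congr (_ *: _).
rewrite /pderiv /sym_of /peval (raddf_sum (mderiv i)) /= raddf_sum /= (bigD1 i) //= big1.
  by rewrite addr0 mderivZ mderivXU eqxx mevalZ mevalC mulr1.
by move=> j ji; rewrite mderivZ mderivXU (negPf ji) mevalZ mevalC mulr0.
Qed.

Lemma lie_act_sym_of x y : lie_act y (sym_of x) = sym_of (bracket y x).
Proof.
apply/eqP; rewrite -subr_eq0; apply/eqP/peval_eq0 => xi.
by rewrite /peval mevalB -!/(peval _ _) lie_actE pdiff_sym_of peval_sym_of subrr.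
Qed.

Lemma poisson_sym_of x f : poisson (sym_of x) f = lie_act x f.
Proof.
apply/eqP; rewrite -subr_eq0; apply/eqP/peval_eq0 => xi.
by rewrite /peval mevalB -!/(peval _ _) lie_actE poissonE pdiff_sym_of subrr.
Qed.

Lemma peval_lie_act x f xi : peval (lie_act x f) xi =
  \sum_i peval (pderiv i f) xi * xi (bracket x (lbase i)).
Proof.
rewrite /lie_act /peval raddf_sum; apply: eq_bigr => i _ /=.
by rewrite mevalM -/(peval (sym_of _) _) peval_sym_of.
Qed.

Lemma lie_act1 x : lie_act x 1 = 0.
Proof.
by rewrite /lie_act big1 // => i _; rewrite /pderiv -mpolyC1 mderivC mul0r.
Qed.

Lemma lie_actD x f g : lie_act x (f + g) = lie_act x f + lie_act x g.
Proof.
by rewrite /lie_act -big_split; apply: eq_bigr => i _; rewrite /pderiv mderivD mulrDl.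
Qed.

Lemma lie_actM x f g : lie_act x (f * g) = lie_act x f * g + f * lie_act x g.
Proof.
rewrite /lie_act mulr_suml mulr_sumr -big_split; apply: eq_bigr => i _.
by rewrite /pderiv mderivM mulrDl mulrA [_ * g * _]mulrAC.
Qed.

Lemma lie_actZ x a f : lie_act x (a *: f) = a *: lie_act x f.
Proof.
by rewrite /lie_act scaler_sumr; apply: eq_bigr => i _; rewrite /pderiv mderivZ -scalerAl.
Qed.

Lemma exp_ad_square0 x : (forall y, bracket x (bracket x y) = 0) ->
  forall y, exp_ad x y = y + bracket x y.
Proof.
move=> x2 y; rewrite /exp_ad sum_lfunE.
have itE k : (iter k (fun h => (ad x \o h)%VF) \1%VF) y = iter k (bracket x) y.
  by elim: k => [|k IH] /=; rewrite ?id_lfunE // comp_lfunE IH lfunE.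
have sumE D : \sum_(m < D.+1)
    ((m`!%:R : F)^-1 *: iter m (fun h => (ad x \o h)%VF) \1%VF) y =
    if D is 0 then y else y + bracket x y.
  case: D => [|d].
    by rewrite big_ord_recl big_ord0 addr0 scale_lfunE itE /= invr1 scale1r.
  rewrite 2!big_ord_recl big1 => [|i _]; last first.
    rewrite scale_lfunE itE; rewrite [iter _ _ _](_ : _ = 0) ?scaler0 //.
    by rewrite /= x2.
  by rewrite !scale_lfunE !itE /= fact0 invr1 !scale1r addr0.
(* In dimension 0 the truncated series stops before the linear term, but [bracket x y] is then
   zero. *)
rewrite sumE; case dimL: (\dim {:L}) => [|d] //.
have : bracket x y \in {:L}%VS by exact: memvf.
by move/eqP: dimL; rewrite dimv_eq0 => /eqP ->; rewrite memv0 => /eqP ->; rewrite addr0.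
Qed.

Lemma coexp_square0 x xi : (forall y, bracket x (bracket x y) = 0) ->
  forall y, coexp x xi y = xi y - xi (bracket x y).
Proof.
move=> x2 y; have n2 z : bracket (- x) (bracket (- x) z) = 0.
  by rewrite -scaleN1r !bracketZl linearZ /= x2 !scaler0.
rewrite comp_lfunE (exp_ad_square0 n2) linearD /= -scaleN1r bracketZl linearZ /=.
by rewrite scaleN1r.
Qed.

(** The orbit of [xi] under [exp (t x)] is a line, along which the derivative of [f] is minus the
    value of [lie_act x f] at the moving point. *)
Lemma coexp_invariant x f : (forall y, bracket x (bracket x y) = 0) ->
  (forall t xi, peval f (coexp (t *: x) xi) = peval f xi) <-> lie_act x f = 0.
Proof.
move=> x2.
have tx2 t z : bracket (t *: x) (bracket (t *: x) z) = 0.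
  by rewrite !bracketZl linearZ /= x2 !scaler0.
pose l xi := mline f (fun i => xi (lbase i)) (fun i => - xi (bracket x (lbase i))).
have ptE xi t y : coexp (t *: x) xi y = xi y + t * - xi (bracket x y).
  by rewrite coexp_square0 // bracketZl linearZ mulrN.
have lE xi t : (l xi).[t] = peval f (coexp (t *: x) xi).
  by rewrite horner_mline; apply: meval_eq => i; rewrite ptE.
have dlE xi t : ((l xi)^`()).[t] = - peval (lie_act x f) (coexp (t *: x) xi).
  rewrite deriv_mline horner_sum peval_lie_act -sumrN; apply: eq_bigr => i _.
  (* The direction of the line computed at the moving point is the same as at [xi], because the
     square of [ad x] vanishes. *)
  rewrite hornerM hornerC horner_mline ptE x2 linear0 oppr0 mulr0 addr0 mulNr mulrC.
  by congr (- (_ * _)); apply: meval_eq => j; rewrite ptE.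
have l0 xi : (l xi).[0] = peval f xi.
  by rewrite lE; apply: meval_eq => i; rewrite ptE mul0r addr0.
split=> [inv|lf0 t xi].
  apply: peval_eq0 => xi; have lc : l xi = (peval f xi)%:P.
    apply/eqP; rewrite -subr_eq0; apply/eqP/(poly_eq0_fun ch) => t.
    by rewrite hornerD hornerN hornerC lE inv subrr.
  have := dlE xi 0; rewrite lc derivC horner0 => /esym/eqP; rewrite oppr_eq0 => /eqP <-.
  by apply: meval_eq => i; rewrite ptE mul0r addr0.
have /(deriv_eq0 ch) lc : (l xi)^`() = 0.
  by apply: (poly_eq0_fun ch) => s; rewrite dlE lf0 /peval meval0 oppr0.
by rewrite -lE -l0 lc !hornerC.
Qed.

End LiePolynomials.

(** * Invariants of the contraction *)

Section KillingDual.
Import VectorInternalTheory.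
Variables (F : fieldType) (g : lieAlgType F).

(** The map sending [a] to the values of [killing a] on the basis is injective between spaces of
    equal dimension. *)
Lemma killing_dual : (forall x : g, (forall y, killing x y = 0) -> x = 0) ->
  forall xi : 'Hom(g, F^o), exists a, forall w, xi w = killing a w.
Proof.
move=> nd xi.
pose row_of (eta : g -> F) : 'rV[F]_(\dim {:g}) := \row_j eta (lbase j).
have lin : linear (fun a => row_of (killing a)).
  move=> c a b; apply/rowP => j.
  by rewrite !mxE killingC linearP /= [killing _ a]killingC [killing _ b]killingC.
pose phi : 'Hom(g, 'rV[F]_(\dim {:g}))
  := Hom (lin1_mx (v2r \o (fun a => row_of (killing a)) \o r2v)).
have phiE a : phi a = row_of (killing a).
  pose T := GRing.isLinear.Build _ _ _ _ _ lin.
  pose lf : {linear g -> 'rV[F]_(\dim {:g})} := HB.pack (fun a => row_of (killing a)) T.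
  rewrite /phi unlock /= /fun_of_lfun_def /=.
  by rewrite (mul_rV_lin1 (v2r \o lf \o r2v)) /= !v2rK.
have ext (eta1 eta2 : {linear g -> F^o}) : row_of eta1 = row_of eta2 -> eta1 =1 eta2.
  move=> /rowP h w; rewrite (coord_vbasis (memvf w)) !linear_sum; apply: eq_bigr => i _.
  by rewrite !linearZ /=; have := h i; rewrite !mxE => ->.
have ker0 : lker phi = 0%VS.
  apply/eqP; rewrite -subv0; apply/subvP => a; rewrite memv_ker phiE memv0.
  move/eqP => ra; apply/eqP/nd => y.
  have /ext : row_of (killing a : {linear g -> F^o}) = row_of (\0 : {linear g -> F^o}).
    by rewrite ra; apply/rowP => j; rewrite !mxE.
  exact.
have : row_of xi \in limg phi.
  suff -> : limg phi = fullv by exact: memvf.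
  apply/eqP; rewrite eqEdim subvf limg_dim_eq ?ker0 ?capv0 //.
  by rewrite [X in (X <= _)%N]dimvf /dim /= mul1n.
case/memv_imgP => a _; rewrite phiE => h; exists a => w.
exact: (ext xi (killing a) h).
Qed.

Lemma killing_involution (theta : involution g) x y :
  killing (theta x) (theta y) = killing x y.
Proof.
pose T : 'M[F]_(dim g) := lin1_mx (v2r \o theta \o r2v).
have TE u : v2r u *m T = v2r (theta u) by rewrite mul_rV_lin1 /= v2rK.
have TT : T *m T = 1%:M.
  by apply: v2r_eqmx => u; rewrite mulmxA !TE involK mulmx1.
have admT z : adm (theta z) = T *m adm z *m T.
  by apply: v2r_eqmx => u; rewrite !mulmxA TE !v2r_adm TE involM involK.
rewrite /killing !admT -!mulmxA (mulmxA T T) TT mul1mx mxtrace_mulC -!mulmxA TT.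
by rewrite mulmx1.
Qed.

End KillingDual.

(** * Invariants of the abelian ideal [gr1] *)

Section Contraction.
Variables (F : closedFieldType) (ch : [pchar F] =i pred0).
Variables (g : lieAlgType F) (ss : semisimple g) (theta : involution g).
Local Notation k := (contraction theta).

(** Applying [theta] to both arguments preserves the form and changes the sign of the first one
    only. *)
Lemma killing_gr1_gr0 x y : x \in gr1 theta -> killing x (pr0 theta y) = 0.
Proof.
rewrite mem_gr1 => /eqP tx.
have := killing_involution theta x (pr0 theta y).
rewrite tx pr0_gr0 -scaleN1r killingC linearZ /= killingC scaleN1r => /eqP.
rewrite -subr_eq0 -opprD oppr_eq0 -mulr2n -mulr_natr mulf_eq0 pchar0_natr // orbF.
by move/eqP.
Qed.

Lemma contr_bracketE (x y : k) : bracket x y = contr_bracket theta x y.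
Proof. by []. Qed.

Lemma gr1P (x : g) : x \in gr1 theta -> theta x = - x.
Proof. by rewrite mem_gr1 => /eqP. Qed.

Lemma contr_bracket_gr1 (x y : g) : x \in gr1 theta ->
  contr_bracket theta x y = bracket x (pr0 theta y).
Proof.
move=> /gr1P tx.
have x0 : pr0 theta x = 0 by rewrite /pr0 tx subrr scaler0.
have x1 : pr1 theta x = x.
  by rewrite -[RHS](pr0_add_pr1 theta) ?x0 ?add0r // pchar0_natr.
by rewrite /contr_bracket x0 x1 !bracket0l !add0r.
Qed.

Lemma contr_bracket_sq (x y : g) : x \in gr1 theta ->
  contr_bracket theta x (contr_bracket theta x y) = 0.
Proof.
move=> xg; rewrite !contr_bracket_gr1 //; set u := pr0 _ _.
suff -> : u = 0 by exact: (linear0 (bracket x)).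
by rewrite /u /pr0 involM (gr1P xg) pr0_gr0 -scaleN1r bracketZl scaleN1r subrr scaler0.
Qed.

Lemma gr1_square0 (x y : k) : x \in gr1 theta -> bracket x (bracket x y) = 0.
Proof. exact: contr_bracket_sq. Qed.

Lemma Ku_invariantE (f : symAlg k) : Ku_invariant f <-> gr1_invariant f.
Proof.
split=> h x xg.
  have sq : forall y : k, bracket x (bracket x y) = 0 by move=> y; exact: gr1_square0.
  by apply/(coexp_invariant ch f sq) => t xi; apply: h; exact: rpredZ.
move=> xi.
have sq : forall y : k, bracket x (bracket x y) = 0 by move=> y; exact: gr1_square0.
by have /(coexp_invariant ch f sq)/(_ 1 xi) := h x xg; rewrite scale1r.
Qed.

Lemma gr1_invariant_poisson (e : g) (f1 f2 : symAlg k) :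
  e \in gr1 theta -> regular e ->
  gr1_invariant f1 -> gr1_invariant f2 -> poisson f1 f2 = 0.
Proof.
move=> eg re inv1 inv2; have nd := killing_nondegenerate ch ss.
apply: (peval_eq0 ch) => xi.
pose zeta : 'Hom(k, F^o) := (linfun (killing e : g -> F^o) : 'Hom(g, F^o)).
have zE (w : g) : zeta w = killing e w by exact: (lfunE (killing e : {linear g -> F^o})).
have [a ha] := killing_dual nd (linfun ((xi : {linear g -> F^o}) \o pr1 theta)).
(* Two parallel lines: [et] joins [zeta] to [xi], [at_] joins [e] to [a], and [at_ t] represents
   [et t] composed with [pr1] through the Killing form. *)
pose et t : 'Hom(k, F^o) := zeta + t *: (xi - zeta).
pose at_ t : g := e + t *: (a - e).
have etE t w : et t (pr1 theta w) = killing (at_ t) w.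
  have ze : zeta (pr1 theta w) = killing e w.
    rewrite zE -[w in RHS](pr0_add_pr1 theta) ?pchar0_natr // linearD /=.
    by rewrite killing_gr1_gr0 // add0r.
  have xe : xi (pr1 theta w) = killing a w by rewrite -ha lfunE.
  rewrite add_lfunE scale_lfunE add_lfunE opp_lfunE ze xe /killing.
  rewrite adm_pencil (linearB (@adm F g)) /=.
  by rewrite mulmxDl -scalemxAl mulmxBl mxtraceD mxtraceZ (linearB (@mxtrace F _)).
pose P :=
  mline (poisson f1 f2) (fun i => zeta (lbase i)) (fun i => (xi - zeta) (lbase i)).
have PE t : P.[t] = peval (poisson f1 f2) (et t).
  by rewrite horner_mline; apply: meval_eq => i; rewrite [RHS]add_lfunE scale_lfunE.
have [p p0 hp] := centraliser_open e (a - e) 0.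
have pn0 : p != 0 by apply: contraNneq p0 => ->; rewrite horner0.
suff P0 : P = 0.
  by have := PE 1; rewrite P0 horner0 /et scale1r addrC subrK.
apply: (poly_eq0_cofinite ch pn0) => t /hp; rewrite scale0r addr0 re -/(at_ t) => le_r.
have rat : regular (at_ t).
  by apply/eqP; rewrite eqn_leq le_r rank_le_centraliser.
have cen f : gr1_invariant f -> bracket (at_ t) (pr0 theta (pdiff f (et t))) = 0 /\
    forall w, et t (bracket (pr1 theta w) (pr0 theta (pdiff f (et t)))) = 0.
  move=> inv; set y := pr0 theta _.
  have h w : et t (bracket (pr1 theta w) y) = 0.
    have wg : pr1 theta w \in gr1 theta by rewrite mem_gr1 pr1_gr1.
    have := lie_actE (pr1 theta w : k) f (et t); rewrite (inv _ wg) /peval meval0 => e0.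
    by rewrite /y -(contr_bracket_gr1 (pdiff f (et t)) wg); exact/esym.
  (* By invariance of the form, [killing [at_ t, y] w] is the value of [et t] at the [pr1] component
     of [[y, w]], that is at [[y, pr1 w]]. *)
  split=> //; apply: nd => w; rewrite killing_inv -etE /y pr1M bracketC linearN /=.
  by rewrite h oppr0.
have [c1 h1] := cen f1 inv1; have [c2 h2] := cen f2 inv2.
(* Of the three terms, the one with both [pr0] components vanishes by commutativity of the
   centraliser of [at_ t], and each mixed one by the invariance of [f1] or [f2]. *)
rewrite PE poissonE (contr_bracketE (pdiff f1 _) (pdiff f2 _)) /contr_bracket.
rewrite (centraliser_abelian ch ss rat c1 c2) add0r linearD /= h2 addr0.
by rewrite bracketC linearN /= h1 oppr0.
Qed.

Lemma gr1_invariant_subalgebra : subalgebra (@gr1_invariant F g theta).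
Proof.
split=> [x _|f1 f2 h1 h2 x xg|f1 f2 h1 h2 x xg|c f h x xg].
- exact: lie_act1.
- by rewrite lie_actD h1 ?h2 ?addr0.
- by rewrite lie_actM h1 ?h2 // mul0r mulr0 addr0.
- by rewrite lie_actZ h ?scaler0.
Qed.

Lemma sym_of_gr1_invariant (x : k) : x \in gr1 theta -> gr1_invariant (sym_of x).
Proof.
move=> xg y yg; rewrite lie_act_sym_of //.
have -> : bracket y x = 0 := @contr11 F g theta y x yg xg.
by rewrite /sym_of big1 // => i _; rewrite linear0 scale0r.
Qed.

End Contraction.

Theorem theorem3p3 (F : closedFieldType) (charF0 : [pchar F] =i pred0)
    (g : lieAlgType F) (ssg : semisimple g)
    (theta : involution g) (Nreg : N_regular theta) :
  (forall f : symAlg (contraction theta),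
      Ku_invariant f <-> gr1_invariant f) /\
  maximal_commutative_subalgebra (@gr1_invariant F g theta).
Proof.
split=> [f|]; first exact: Ku_invariantE.
case: Nreg => e [eg _ re]; split.
  split; first exact: gr1_invariant_subalgebra.
  by move=> f1 f2; exact: (gr1_invariant_poisson charF0 ssg eg re).
move=> B [_ commB] sAB f Bf x xg.
rewrite -(poisson_sym_of charF0); apply: commB => //.
exact/sAB/sym_of_gr1_invariant.
Qed.
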